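(* Let $n\ge1$. The map $$G=(w_{ij})\longmapsto\mathbb{I}(G)=\prod_{1\le i<j\le n+3}A_{ij}^{w_{ij}}$$ is a bijection from the set of weighted graphs on the $(n+3)$-gon to $\mathbf{P}(\widetilde{\mathcal{A}}_{A_n})$. Furthermore, for weighted graphs $G_1,G_2$, one has $\mathbb{I}(G_1)\le\mathbb{I}(G_2)$ if and only if $$R_p(G_1)=R_p(G_2)\ \text{ for all vertices } p,\qquad I_{kl}(G_1)\le I_{kl}(G_2)\ \text{ for all diagonals }\{kl\}.$$
   Context: Fix an $(n+3)$-gon with vertices labeled $1,\dots,n+3$ clockwise. A segment $\{ij\}$ joins two distinct vertices; it is an edge if they are adjacent and a diagonal otherwise. A complete triangulation $T$ is a maximal set of pairwise non-crossing diagonals; $\widetilde T$ is $T$ together with all edges. $\widetilde{\mathcal{A}}_{A_n}$ is the positive space with one coordinate system $\{A_{ij}:\{ij\}\in\widetilde T\}$ (a torus) for each complete triangulation $T$, glued via the transition maps generated by the Plücker relations $A_{ik}A_{jl}=A_{ij}A_{kl}+A_{il}A_{jk}$, where $i,j,k,l$ are distinct vertices in clockwise cyclic order. $\mathbb{L}_+(\widetilde{\mathcal{A}}_{A_n})$ is the set of functions which are Laurent polynomials with non-negative integer coefficients in every such coordinate system. $\mathbf{E}(\widetilde{\mathcal{A}}_{A_n})$ is the set of nonzero elements of $\mathbb{L}_+$ that are not a sum of two nonzero elements of $\mathbb{L}_+$, and $\mathbf{P}(\widetilde{\mathcal{A}}_{A_n})$ is the set of finite products of elements of $\mathbf{E}(\widetilde{\mathcal{A}}_{A_n})$.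 For $F_1,F_2\in\mathbb{L}_+$, write $F_1\ge F_2$ if $F_1-F_2\in\mathbb{L}_+$ (zero included). A weighted graph is a collection of segments of the $(n+3)$-gon with integral weights such that the weights of diagonals are non-negative (weights of edges may be any integers). It is presented by a symmetric matrix $G=(w_{ij})$ with $w_{ij}$ the weight of $\{ij\}$ for $i\ne j$ and $w_{ii}=0$. Put $R_p(G)=\sum_{1\le j\le n+3}w_{pj}$ and, for $k<l$, $I_{kl}(G)=\sum_{i\in I,\,j\in J}w_{ij}$ with $I=\{k+1,\dots,l\}$ and $J=\{1,\dots,n+3\}\setminus I$. *)

(* Defs.v *)
From HB Require Import structures.
From mathcomp Require Import all_boot all_order all_algebra.
From mathcomp Require Import mpoly.
From mathcomp Require Import ring zify generic_quotient.

Set Implicit Arguments.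
Unset Strict Implicit.
Unset Printing Implicit Defensive.

Import Order.TTheory GRing.Theory Num.Theory.
Local Open Scope ring_scope.

Section Polygon.
Variable n : nat.

(* Vertices 1, ..., n+3 are represented by 0, ..., n+2 : 'I_n.+3, and the      *)
(* segment {ij} by the ordered pair (i, j) with i < j.                        *)
Definition vertex := 'I_n.+3.
Definition segment := (vertex * vertex)%type.

Definition is_segment (s : segment) : bool := (s.1 < s.2)%N.

Definition is_edge (s : segment) : bool :=
  is_segment s &&
  ((s.2 == s.1.+1 :> nat) || ((s.1 == 0 :> nat) && (s.2 == n.+2 :> nat))).

Definition is_diagonal (s : segment) : bool := is_segment s && ~~ is_edge s.

Definition crossing (s t : segment) : bool :=
  [|| [&& s.1 < t.1, t.1 < s.2 & s.2 < t.2]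
    | [&& t.1 < s.1, s.1 < t.2 & t.2 < s.2]]%N.

Definition noncrossing_diagonals (T : {set segment}) : bool :=
  [forall s in T, is_diagonal s] &&
  [forall s in T, forall t in T, ~~ crossing s t].

Definition complete_triangulation (T : {set segment}) : bool :=
  maxset noncrossing_diagonals T.

Definition with_edges (T : {set segment}) : {set segment} :=
  T :|: [set s | is_edge s].

End Polygon.

Section Coordinates.
Variables (n : nat) (K : fieldType) (A : 'I_n.+3 -> 'I_n.+3 -> K).

Definition coordinates (S : {set segment n}) (k : 'I_#|S|) : K :=
  A (enum_val k).1 (enum_val k).2.

(* The value at the coordinates A_s, s in S, of an integer polynomial. *)
Definition poly_in (S : {set segment n}) (p : {mpoly int[#|S|]}) : K :=
  mmap intr (@coordinates S) p.

Definition algebraically_independent (S : {set segment n}) : Prop :=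
  forall p : {mpoly int[#|S|]}, poly_in p = 0 -> p = 0.

Definition generates_field (S : {set segment n}) : Prop :=
  forall f : K, exists p q : {mpoly int[#|S|]},
    poly_in q != 0 /\ f = poly_in p / poly_in q.

(* A Laurent polynomial is a polynomial divided by a monomial. *)
Definition positive_laurent (S : {set segment n}) (f : K) : Prop :=
  exists (p : {mpoly int[#|S|]}) (m : 'X_{1..#|S|}),
    (forall a : 'X_{1..#|S|}, 0 <= p@_a) /\
    f = poly_in p / mmap1 (@coordinates S) m.

End Coordinates.

(* Gluing the tori (one for each T) along birational maps identifies their    *)
(* function fields, so functions on the space live in one field, which        *)
(* contains all the A_ij.  The coordinates of each chart are free generators  *)
(* of that field, and the charts are related by the Plücker relations.  These *)
(* data are unique up to a unique isomorphism, because each flip relation     *)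
(* determines the new coordinate; [positive_space_exists] constructs them.    *)
(* The Plücker relation is unchanged by a rotation of the cyclic order        *)
(* i, j, k, l, so i < j < k < l covers all cases.  The values A_ii play no     *)
(* role.                                                                      *)
Record positive_space (n : nat) := PositiveSpace {
  function_field :> fieldType;
  A : 'I_n.+3 -> 'I_n.+3 -> function_field;
  A_sym : forall i j, A i j = A j i;
  plucker : forall i j k l : 'I_n.+3, (i < j < k)%N -> (k < l)%N ->
    A i k * A j l = A i j * A k l + A i l * A j k;
  chart_independent : forall T, complete_triangulation T ->
    algebraically_independent A (with_edges T);
  chart_generates : forall T, complete_triangulation T ->
    generates_field A (with_edges T)
}.
Arguments A {n} p i j : rename.

Section Positivity.
Variables (n : nat) (X : positive_space n).

Definition Lplus (f : X) : Prop :=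
  forall T, complete_triangulation T -> positive_laurent (A X) (with_edges T) f.

Definition extremal (f : X) : Prop :=
  [/\ Lplus f, f != 0 &
      ~ exists f1 f2 : X,
          [/\ Lplus f1, f1 != 0, Lplus f2, f2 != 0 & f = f1 + f2]].

Definition extremal_product (f : X) : Prop :=
  exists s : seq X, (forall g, g \in s -> extremal g) /\ f = \prod_(g <- s) g.

Definition Lle (f1 f2 : X) : Prop := Lplus (f2 - f1).

End Positivity.

Section WeightedGraphs.
Variable n : nat.

Definition weighted_graph : pred 'M[int]_n.+3 := fun G =>
  [&& G^T == G,
      [forall i, G i i == 0] &
      [forall i, forall j, is_diagonal (i, j) ==> (0 <= G i j)]].

Definition graph_monomial (X : positive_space n) (G : 'M[int]_n.+3) : X :=
  \prod_(i < n.+3) \prod_(j < n.+3 | (i < j)%N) A X i j ^ G i j.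

Definition vertex_weight (p : 'I_n.+3) (G : 'M[int]_n.+3) : int :=
  \sum_(j < n.+3) G p j.

Definition cut_weight (k l : 'I_n.+3) (G : 'M[int]_n.+3) : int :=
  \sum_(i < n.+3 | (k < i <= l)%N) \sum_(j < n.+3 | ~~ (k < j <= l)%N) G i j.

End WeightedGraphs.

Section Triangulations.
Variables (n : nat) (T : {set segment n}).
Hypothesis triT : complete_triangulation T.

Lemma with_edges_segment s : s \in with_edges T -> is_segment s.
Proof.
case/maxsetP: triT => /andP[/forallP dT _] _.
rewrite !inE => /orP[sT|/andP[] //].
by have /implyP/(_ sT)/andP[] := dT s.
Qed.

Lemma edge_with_edges s : is_edge s -> s \in with_edges T.
Proof. by move=> es; rewrite !inE es orbT. Qed.

Lemma edge_not_crossing (s t : segment n) : is_edge s -> is_segment t ->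
  ~~ crossing s t && ~~ crossing t s.
Proof.
case: s t => [a b] [c d]; rewrite /is_edge /is_segment /crossing /=.
have := ltn_ord d; have := ltn_ord b.
by move: (val a) (val b) (val c) (val d) => {}a {}b {}c {}d /=; lia.
Qed.

Lemma with_edges_not_crossing s t :
  s \in with_edges T -> t \in with_edges T -> ~~ crossing s t.
Proof.
move=> sT tT; have sseg := with_edges_segment sT.
have tseg := with_edges_segment tT.
move: sT tT; rewrite !inE.
case/orP=> [sT|es]; last by have /andP[] := edge_not_crossing es tseg.
case/orP=> [tT|et]; last by have /andP[] := edge_not_crossing et sseg.
case/maxsetP: triT => /andP[_ /forallP cT] _.
by have /implyP/(_ sT)/forallP/(_ t)/implyP/(_ tT) := cT s.
Qed.

Lemma with_edges_max s : is_segment s ->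
  (forall t, t \in with_edges T -> ~~ crossing s t) -> s \in with_edges T.
Proof.
move=> sseg ncs; rewrite !inE; case: (boolP (is_edge s)) => [|nes].
  by rewrite orbT.
rewrite orbF; case/maxsetP: triT => /andP[/forallP dT /forallP cT] maxT.
have crossC (t u : segment n) : crossing t u = crossing u t by rewrite /crossing orbC.
have ncT t : t \in T -> ~~ crossing s t by move=> tT; apply: ncs; rewrite inE tT.
have ncss : ~~ crossing s s by rewrite /crossing !ltnn.
suff : noncrossing_diagonals (s |: T).
  by move/maxT => <-; rewrite ?subsetUr // !inE eqxx.
apply/andP; split.
  apply/forallP => t; apply/implyP; rewrite !inE => /orP[/eqP->|tT].
    by rewrite /is_diagonal sseg.
  by have /implyP/(_ tT) := dT t.
apply/forallP => t; apply/implyP => tT; apply/forallP => u; apply/implyP.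
move: tT; rewrite !inE => /orP[/eqP->|tT] /orP[/eqP->|uT] //.
- exact: ncT.
- by rewrite crossC ncT.
by have /implyP/(_ tT)/forallP/(_ u)/implyP/(_ uT) := cT t.
Qed.

Lemma triangle_on (i j : 'I_n.+3) : (i, j) \in with_edges T -> (i.+1 < j)%N ->
  exists m : 'I_n.+3, [/\ (i < m)%N, (m < j)%N, (i, m) \in with_edges T &
                                                (m, j) \in with_edges T].
Proof.
move=> ijT ltij.
have jn := ltn_ord j.
have lti1 : (i.+1 < n.+3)%N by lia.
pose P (m : 'I_n.+3) := [&& (i < m)%N, (m < j)%N & (i, m) \in with_edges T].
have P0 : P (Ordinal lti1).
  rewrite /P /= ltnSn ltij /=; apply: edge_with_edges.
  by rewrite /is_edge /is_segment /= ltnSn eqxx.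
case: (arg_maxnP (fun m : 'I_n.+3 => val m) P0) => m /and3P[im mj imT] maxm.
exists m; split => //; apply: with_edges_max => // -[a b] abT.
have := with_edges_not_crossing abT imT; have := with_edges_not_crossing abT ijT.
have /= := with_edges_segment abT.
rewrite /is_segment /crossing /= => ab c1 c2; apply/negP => C.
have [ai|ai] := eqVneq a i; last first.
  have nai : (a != i :> nat) by [].
  by lia.
have Pb : (m < b < j)%N -> P b.
  by case/andP=> mb bj; rewrite /P -ai abT bj andbT ai (ltn_trans im mb).
have maxb : ~~ (m < b < j)%N.
  by apply/negP => mbj; have /= := maxm b (Pb mbj); rewrite leqNgt; case/andP: mbj => ->.
have ai' : a = i :> nat by rewrite ai.
by lia.
Qed.

End Triangulations.

Section Realization.
Variables (n : nat) (T : {set segment n}) (F : fieldType).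
Hypothesis triT : complete_triangulation T.

Let det (u v : F * F) : F := u.1 * v.2 - u.2 * v.1.

Variable t : segment n -> F.
Hypothesis t_neq0 : forall s, s \in with_edges T -> t s != 0.

Lemma realize_interval d (i j : 'I_n.+3) (wi wj : F * F) : (j - i <= d)%N ->
  (i, j) \in with_edges T -> det wi wj = t (i, j) ->
  exists w : 'I_n.+3 -> F * F, [/\ w i = wi, w j = wj &
    forall k l : 'I_n.+3, (i <= k)%N -> (l <= j)%N -> (k, l) \in with_edges T ->
      det (w k) (w l) = t (k, l)].
Proof.
elim: d i j wi wj => [|d IHd] i j wi wj led ijT dij.
  by have := with_edges_segment triT ijT; rewrite /is_segment /=; lia.
have /= ltij := with_edges_segment triT ijT; rewrite /is_segment /= in ltij.
have [ltSij|geSij] := ltnP i.+1 j; last first.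
  exists (fun k => if k == i then wi else wj); rewrite eqxx; split => //.
    by case: eqP => // ji; rewrite ji ltnn in ltij.
  move=> k l ik lj klT; have := with_edges_segment triT klT.
  rewrite /is_segment /= => kl.
  have -> : k = i by apply/val_inj => /=; lia.
  have -> : l = j by apply/val_inj => /=; lia.
  by rewrite eqxx; case: eqP => // ji; rewrite ji ltnn in ltij.
have [m [im mj imT mjT]] := triangle_on triT ijT ltSij.
have tij0 := t_neq0 ijT.
pose a := t (m, j) / t (i, j); pose b := t (i, m) / t (i, j).
pose wm := (a * wi.1 + b * wj.1, a * wi.2 + b * wj.2).
have dim : det wi wm = t (i, m).
  transitivity (b * det wi wj); first by rewrite /det /wm /=; ring.
  by rewrite dij /b divfK.
have dmj : det wm wj = t (m, j).
  transitivity (a * det wi wj); first by rewrite /det /wm /=; ring.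
  by rewrite dij /a divfK.
have [|w1 [w1i w1m w1T]] := IHd i m wi wm _ imT dim; first by lia.
have [|w2 [w2m w2j w2T]] := IHd m j wm wj _ mjT dmj; first by lia.
exists (fun k : 'I_n.+3 => if (k <= m)%N then w1 k else w2 k); split.
- by rewrite (ltnW im).
- by rewrite leqNgt mj.
move=> k l ik lj klT; have kl := with_edges_segment triT klT.
rewrite /is_segment /= in kl.
have [lm|ml] := leqP l m; first by rewrite (leq_trans (ltnW kl) lm) w1T.
have [mk|km] := leqP m k.
  have -> : (if (k <= m)%N then w1 k else w2 k) = w2 k.
    case: leqP => // km; have -> : k = m by apply/val_inj => /=; lia.
    by rewrite w1m w2m.
  by rewrite w2T.
rewrite (ltnW km).
have c1 := with_edges_not_crossing triT klT imT.
have c2 := with_edges_not_crossing triT klT mjT.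
rewrite /crossing /= in c1 c2.
have -> : k = i by apply/val_inj => /=; lia.
have -> : l = j.
  apply/val_inj => /=; lia.
by rewrite w1i w2j.
Qed.

End Realization.
Lemma rmorph_mmap k (S S' : comNzRingType) (f : {rmorphism S -> S'})
    (h : 'I_k -> S) (p : {mpoly int[k]}) :
  f (mmap intr h p) = mmap intr (f \o h) p.
Proof.
rewrite /mmap rmorph_sum; apply: eq_bigr => m _.
rewrite rmorphM rmorph_int; congr (_ * _).
by rewrite /mmap1 rmorph_prod; apply: eq_bigr => i _; rewrite rmorphXn.
Qed.

Section Generation.
Variables (n : nat) (K : fieldType) (a : 'I_n.+3 -> 'I_n.+3 -> K).
Variable S : {set segment n}.

Let gen (f : K) := exists p q : {mpoly int[#|S|]},
  poly_in a q != 0 /\ f = poly_in a p / poly_in a q.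

Lemma gen_poly (p : {mpoly int[#|S|]}) : gen (poly_in a p).
Proof. by exists p, 1; rewrite /poly_in rmorph1 oner_eq0 divr1. Qed.

Lemma genD f g : gen f -> gen g -> gen (f + g).
Proof.
move=> [p [q [q0 ->]]] [r [s [s0 ->]]].
exists (p * s + r * q), (q * s); rewrite /poly_in !(rmorphD, rmorphM) /=.
by rewrite mulf_neq0 // -addf_div.
Qed.

Lemma genM f g : gen f -> gen g -> gen (f * g).
Proof.
move=> [p [q [q0 ->]]] [r [s [s0 ->]]].
exists (p * r), (q * s); rewrite /poly_in !rmorphM /=.
by rewrite mulf_neq0 // mulf_div.
Qed.

Lemma genV f : gen f -> gen f^-1.
Proof.
move=> [p [q [q0 ->]]]; have [p0|p0] := eqVneq (poly_in a p) 0.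
  by rewrite p0 mul0r invr0 -(rmorph0 (mmap intr (@coordinates _ _ a S))); exact: gen_poly.
by exists q, p; rewrite invf_div.
Qed.

Lemma gen_int z : gen z%:~R.
Proof. by rewrite -(rmorph_int (mmap intr (@coordinates _ _ a S))); exact: gen_poly. Qed.

Lemma genN f : gen f -> gen (- f).
Proof. by move=> gf; rewrite -mulN1r; apply: genM gf; exact: (gen_int (-1)). Qed.

Lemma gen_mmap k (h : 'I_k -> K) (p : {mpoly int[k]}) :
  (forall i, gen (h i)) -> gen (mmap intr h p).
Proof.
move=> gh; rewrite /mmap; apply: big_ind; [exact: (gen_int 0)|exact: genD|].
move=> m _; apply: genM; first exact: gen_int.
rewrite /mmap1; apply: big_ind; [exact: (gen_int 1)|exact: genM|].
move=> i _; elim: (m i) => [|e IHe]; first exact: (gen_int 1).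
by rewrite exprS; apply: genM.
Qed.

Lemma gen_coord i j : (i, j) \in S -> gen (a i j).
Proof.
move=> ijS; have -> : a i j = poly_in a ('X_(enum_rank_in ijS (i, j)) : {mpoly int[#|S|]}).
  by rewrite /poly_in mmapX mmap1U /coordinates enum_rankK_in.
exact: gen_poly.
Qed.

End Generation.

Section GenerationTriangulation.
Variables (n : nat) (K : fieldType) (a : 'I_n.+3 -> 'I_n.+3 -> K).
Variable T : {set segment n}.
Hypothesis triT : complete_triangulation T.
Hypothesis a_neq0 : forall i j : 'I_n.+3, (i < j)%N -> a i j != 0.
Hypothesis pl : forall i j k l : 'I_n.+3, (i < j < k)%N -> (k < l)%N ->
  a i k * a j l = a i j * a k l + a i l * a j k.

Let gen (f : K) := exists p q : {mpoly int[#|with_edges T|]},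
  poly_in a q != 0 /\ f = poly_in a p / poly_in a q.

Lemma gen_interval d (i j k l : 'I_n.+3) : (j - i <= d)%N ->
  (i, j) \in with_edges T -> (i <= k)%N -> (k < l)%N -> (l <= j)%N -> gen (a k l).
Proof.
elim: d i j k l => [|d IHd] i j k l led ijT ik kl lj; first by lia.
have [ltSij|geSij] := ltnP i.+1 j; last first.
  have -> : k = i by apply/val_inj => /=; lia.
  have -> : l = j by apply/val_inj => /=; lia.
  exact: gen_coord.
have [m [im mj imT mjT]] := triangle_on triT ijT ltSij.
have gl (u v : 'I_n.+3) : (i <= u)%N -> (u < v)%N -> (v <= m)%N -> gen (a u v).
  by move=> *; apply: (IHd i m) => //; lia.
have gr (u v : 'I_n.+3) : (m <= u)%N -> (u < v)%N -> (v <= j)%N -> gen (a u v).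
  by move=> *; apply: (IHd m j) => //; lia.
have solve x y z : x != 0 -> gen x -> gen z -> x * y = z -> gen y.
  move=> x0 gx gz xy.
  by rewrite (_ : y = x^-1 * z); [apply: genM gz; apply: genV|rewrite -xy mulKf].
have gij : gen (a i j) by exact: gen_coord.
have [lm|ml] := leqP l m; first exact: gl.
have [mk|km] := leqP m k; first exact: gr.
have gil : gen (a i l).
  have [/val_inj->//|nlj] := eqVneq (l : nat) j.
  apply: (solve (a m j) _ (a i j * a m l + a i m * a l j)).
  - exact: a_neq0.
  - exact: gen_coord.
  - have gml : gen (a m l) by apply: gr.
    have gim : gen (a i m) by exact: gen_coord.
    have glj : gen (a l j) by apply: gr => //; lia.
    exact: genD (genM gij gml) (genM gim glj).
  rewrite mulrC [RHS]addrC; apply: pl; first by rewrite im.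
  by rewrite ltn_neqAle nlj.
have [/val_inj->//|nki] := eqVneq (k : nat) i.
apply: (solve (a i m) _ (a i k * a m l + a i l * a k m)).
- exact: a_neq0.
- exact: gen_coord.
- have gik : gen (a i k) by apply: gl; lia.
  have gml : gen (a m l) by apply: gr.
  have gkm : gen (a k m) by apply: gl.
  exact: genD (genM gik gml) (genM gil gkm).
apply: pl => //; by rewrite ltn_neqAle eq_sym nki ik.
Qed.

Lemma gen_all (k l : 'I_n.+3) : (k < l)%N -> gen (a k l).
Proof.
move=> kl; apply: (@gen_interval n.+2 ord0 ord_max) => //=.
- by apply: edge_with_edges; rewrite /is_edge /is_segment /= eqxx.
by rewrite -ltnS.
Qed.

End GenerationTriangulation.

(* The points of the space are configurations of n+3 vectors v_j of a plane,  *)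
(* with A_ij = det(v_i, v_j) for i < j.  Normalizing v_0 = (1, 0) and         *)
(* v_1 = (0, x_1), and writing v_j = (- y_j, x_j), the field is that of the   *)
(* rational functions in the n+2 variables x_j and the n+1 variables y_j.     *)
Section Model.
Variable n : nat.

Let R := {mpoly int[n.+2 + n.+1]}.

Definition model_x (j : 'I_n.+3) : R :=
  if (j == 0 :> nat) then 0 else 'X_(lshift _ (inord j.-1)).

Definition model_y (j : 'I_n.+3) : R :=
  if (j == 0 :> nat) then -1 else
  if (j == 1 :> nat) then 0 else 'X_(rshift _ (inord j.-2)).

Definition model_det (i j : 'I_n.+3) : R :=
  model_x i * model_y j - model_x j * model_y i.

Definition model_coord (i j : 'I_n.+3) : {fraction R} :=
  FracField.tofrac (if (i <= j)%N then model_det i j else model_det j i).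

Let o0 : 'I_n.+3 := ord0.
Let o1 : 'I_n.+3 := Ordinal (isT : 1 < n.+3)%N.

Lemma model_coord_lt (i j : 'I_n.+3) : (i < j)%N ->
  model_coord i j = FracField.tofrac (model_det i j).
Proof. by move=> ij; rewrite /model_coord ltnW. Qed.

Lemma model_coord_sym i j : model_coord i j = model_coord j i.
Proof.
rewrite /model_coord; case: ltngtP => // /val_inj ->.
by [].
Qed.

Lemma model_plucker (i j k l : 'I_n.+3) : (i < j < k)%N -> (k < l)%N ->
  model_coord i k * model_coord j l =
  model_coord i j * model_coord k l + model_coord i l * model_coord j k.
Proof.
case/andP=> ij jk kl; have ik := ltn_trans ij jk; have jl := ltn_trans jk kl.
rewrite !model_coord_lt ?(ltn_trans ik kl) // -!tofracM -tofracD.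
by congr FracField.tofrac; rewrite /model_det; ring.
Qed.

Section Evaluation.
Variables (F : fieldType) (w : 'I_n.+3 -> F * F).

Let b (i j : 'I_n.+3) : F := (w i).1 * (w j).2 - (w i).2 * (w j).1.

Hypothesis b01 : b o0 o1 != 0.

Definition model_point (k : 'I_(n.+2 + n.+1)) : F :=
  match split k with
  | inl i => b o0 (inord i.+1)
  | inr i => b o1 (inord i.+2) / b o0 o1
  end.

Lemma model_point_det i j : mmap intr model_point (model_det i j) = b i j.
Proof.
have evx k : mmap intr model_point (model_x k) = b o0 k.
  rewrite /model_x; case: eqP => [k0|/eqP k0].
    have -> : k = o0 by apply/val_inj.
    by rewrite rmorph0 /b; ring.
  rewrite mmapX mmap1U /model_point (unsplitK (inl _)) inordK.
    by congr (b _ _); apply/val_inj; rewrite /= inordK prednK // lt0n.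
  by have := ltn_ord k; lia.
have evy k : mmap intr model_point (model_y k) = b o1 k / b o0 o1.
  rewrite /model_y; case: eqP => [k0|/eqP k0].
    have -> : k = o0 by apply/val_inj.
    rewrite rmorphN1; apply: (mulIf b01); rewrite divfK //.
    by rewrite /b; ring.
  case: eqP => [k1|/eqP k1].
    have -> : k = o1 by apply/val_inj.
    rewrite rmorph0 (_ : b o1 o1 = 0) ?mul0r //.
    by rewrite /b; ring.
  have kn := ltn_ord k.
  rewrite mmapX mmap1U /model_point (unsplitK (inr _)) inordK; last by lia.
  by congr (b _ _ / _); apply/val_inj; rewrite /= inordK; lia.
rewrite /model_det rmorphB !rmorphM /= !evx !evy.
apply: (mulIf b01); rewrite mulrBl !mulrA !divfK //.
by rewrite /b; ring.
Qed.

End Evaluation.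

Lemma edge01 : is_edge (o0, o1). Proof. by []. Qed.

Lemma model_independent T : complete_triangulation T ->
  algebraically_independent model_coord (with_edges T).
Proof.
move=> triT p p0.
have e01 := edge_with_edges T edge01.
pose F := {fraction {mpoly int[#|with_edges T|]}}.
pose t s : F := FracField.tofrac 'X_(enum_rank_in e01 s).
have t_neq0 s : s \in with_edges T -> t s != 0.
  move=> _; rewrite tofrac_eq0; apply/eqP => /(congr1 (mcoeff U_(enum_rank_in e01 s))).
  by rewrite mcoeffXU eqxx mcoeff0 => /eqP; rewrite oner_eq0.
have e0m : (o0, ord_max) \in with_edges T.
  by apply: edge_with_edges; rewrite /is_edge /is_segment /= eqxx.
have d0m : (1 : F) * t (o0, ord_max) - 0 * (0 : F) = t (o0, ord_max).
  by rewrite mul1r mul0r subr0.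
have [w [_ _ wT]] := realize_interval triT t_neq0
  (wi := (1, 0)) (wj := (0, t (o0, ord_max))) (leqnn _) e0m d0m.
have wS i j : (i, j) \in with_edges T ->
    (w i).1 * (w j).2 - (w i).2 * (w j).1 = t (i, j).
  by move=> ijT; apply: wT => //; have := ltn_ord j; rewrite /=; lia.
have w01 : (w o0).1 * (w o1).2 - (w o0).2 * (w o1).1 != 0.
  by rewrite wS // t_neq0.
pose h (k : 'I_#|with_edges T|) : R :=
  model_det (enum_val k).1 (enum_val k).2.
have hp : mmap intr h p = 0.
  apply/eqP; rewrite -tofrac_eq0.
  rewrite (rmorph_mmap (@FracField.tofrac R)); apply/eqP.
  rewrite -p0 /poly_in; apply: eq_bigr => m _; congr (_ * _).
  apply: mmap1_eq => k; rewrite /= /coordinates model_coord_lt //.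
  by have := with_edges_segment triT (enum_valP k).
have pE : p = mmap intr (fun k => 'X_k) p.
  rewrite {1}[p]mpolyE; apply: eq_bigr => m _.
  by rewrite mmap1_id -mul_mpolyC -[in LHS](intz p@_m) rmorph_int.
apply/eqP; rewrite -tofrac_eq0 pE.
rewrite (rmorph_mmap (@FracField.tofrac _)).
rewrite -(rmorph0 (mmap intr (model_point w))) -hp rmorph_mmap.
apply/eqP/eq_bigr => m _; congr (_ * _); apply: mmap1_eq => k /=.
rewrite /h model_point_det // wS -?surjective_pairing ?enum_valP //.
by rewrite /t enum_valK_in.
Qed.

Lemma model_coord_neq0 (i j : 'I_n.+3) : (i < j)%N -> model_coord i j != 0.
Proof.
move=> ij; rewrite model_coord_lt // tofrac_eq0; apply/eqP => d0.
pose w (k : 'I_n.+3) : rat * rat := (1, k%:R).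
have w01 : (w o0).1 * (w o1).2 - (w o0).2 * (w o1).1 != 0 by [].
have := model_point_det w01 i j; rewrite d0 rmorph0 /= => /esym/eqP.
by rewrite mul1r mulr1 subr_eq0 eqr_nat => /eqP ji; rewrite ji ltnn in ij.
Qed.

Lemma model_generates T : complete_triangulation T ->
  generates_field model_coord (with_edges T).
Proof.
move=> triT f.
pose gen (g : {fraction R}) := exists p q : {mpoly int[#|with_edges T|]},
  poly_in model_coord q != 0 /\ g = poly_in model_coord p / poly_in model_coord q.
have gA (i j : 'I_n.+3) : (i < j)%N -> gen (model_coord i j).
  by apply: gen_all; [exact: triT|exact: model_coord_neq0|exact: model_plucker].
have gx (k : 'I_n.+2) : gen (FracField.tofrac 'X_(lshift _ k)).
  have := gA o0 (lift ord0 k) isT; rewrite model_coord_lt // /model_det.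
  rewrite /model_x /model_y /= mulrN1 mul0r sub0r opprK.
  by rewrite (_ : inord _ = k) // -[RHS]inord_val; congr inord.
have gy (k : 'I_n.+1) : gen (FracField.tofrac 'X_(rshift _ k)).
  have g1k := gA o1 (lift ord0 (lift ord0 k)) isT.
  have g01 := gA o0 o1 isT; have n01 := model_coord_neq0 (isT : (o0 < o1)%N).
  have <- : model_coord o1 (lift ord0 (lift ord0 k)) / model_coord o0 o1 =
            FracField.tofrac 'X_(rshift _ k).
    apply: (mulIf n01); rewrite divfK // !model_coord_lt // -tofracM.
    congr FracField.tofrac; rewrite /model_det /model_x /model_y /=.
    rewrite (_ : inord _ = k); last by rewrite -[RHS]inord_val; congr inord.
    by rewrite mulr0 mul0r subr0 sub0r mulrN1 opprK mulrC.
  by apply: genM => //; apply: genV.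
have gR (r : R) : gen (FracField.tofrac r).
  have -> : r = mmap intr (fun k => 'X_k) r.
    rewrite {1}[r]mpolyE; apply: eq_bigr => m _.
    by rewrite mmap1_id -mul_mpolyC -[in LHS](intz r@_m) rmorph_int.
  rewrite (rmorph_mmap (@FracField.tofrac _)); apply: gen_mmap => k /=.
  by case: (split_ordP k) => i ->; [exact: gx|exact: gy].
have [[u v] v0 ->] : exists2 x : R * R, x.2 != 0 &
    f = FracField.tofrac x.1 / FracField.tofrac x.2.
  elim/quotW: f => f; exists (\n_f, \d_f); first exact: denom_ratioP.
  apply: (mulIf (_ : FracField.tofrac \d_f != 0)).
    by rewrite tofrac_eq0 denom_ratioP.
  rewrite divfK ?tofrac_eq0 ?denom_ratioP //.
  rewrite (_ : _ * _ = FracField.mul (\pi_(FracField.type R) f)%qT (FracField.tofrac \d_f)) //.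
  unlock FracField.tofrac; rewrite -[LHS]FracField.pi_mul; apply/eqmodP => /=.
  rewrite FracField.equivfE !numden_Ratio ?mulf_neq0 ?oner_eq0 ?denom_ratioP //.
  by rewrite !mulr1 mulrC.
exact: (genM (gR u) (genV (gR v))).
Qed.

Lemma positive_space_exists : inhabited (positive_space n).
Proof.
exact: inhabits (PositiveSpace model_coord_sym model_plucker
                   model_independent model_generates).
Qed.

End Model.

(* Main.v *)
Require Import Defs.
From HB Require Import structures.
From mathcomp Require Import all_boot all_order all_algebra.
From mathcomp Require Import ssrcomplements mpoly.
From mathcomp Require Import ring lra zify.

Set Implicit Arguments.
Unset Strict Implicit.
Unset Printing Implicit Defensive.

Import Order.TTheory GRing.Theory Num.Theory.
Local Open Scope ring_scope.

(** Write [I G] for the monomial of a weighted graph [G].  Cutting the polygon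
    along a triangulation expresses every [A_ij] as a Laurent polynomial with
    non-negative coefficients in the coordinates of the chart
    ([universal_segment]).  The formula follows from the Plücker relations alone,
    so it holds for every family of field elements that satisfies them; since the
    coordinates of a chart are independent, an identity between the [A_ij] on the
    space therefore holds for all such configurations ([transfer]).  They serve as
    test points.

    The order.  If [I G2 - I G1] is positive in a single chart, then
    [I G1 <= I G2] at every configuration of plane vectors with positive
    determinants.  Letting one vector grow or shrink, or moving the vectors of
    consecutive vertices far away from the others, and comparing the rates of
    growth gives the equalities of the [R_p] and the inequalities of the [I_kl]
    ([chart_below]).  Conversely, let [D (a, b)] be the difference of the cuts of
    [G2] and [G1] between two gaps [a] and [b] of the polygon.  It is a
    non-negative even symmetric function on pairs of gaps, and its mixed second
    difference at two vertices is twice the difference of the weights of the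
    segment that joins them ([cut_mixed]).  If [D] is not zero, there is a
    rectangle of pairs of gaps on which it is positive, such that the segments at
    two opposite corners have positive weights in [G2] ([positive_rectangle]).
    These segments cross, and one of the two ways to resolve the crossing lowers
    by two exactly the cuts in the rectangle.  The Plücker relation thus writes
    [I G2] as the sum of two monomials, one of which is still above [I G1], and an
    induction concludes ([below_Lle]).  The mixed differences
    also show that the cuts determine the graph, whence the injectivity, and the
    rectangle shows that nothing but [G] itself lies below a graph [G] without
    crossings ([below_noncrossing]).

    The extremal elements.  A noncrossing graph [G] lives in a chart, where [I G]
    is a Laurent monomial with coefficient one and cannot be split
    ([noncrossing_extremal]); this covers the [A_ij] and the inverses of the
    edges, so that each [I G] is a product of extremal elements.  Conversely, let
    [F] be in [L_+], and let [c G] be the coefficient of [I G] in the expansion of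
    [F] in a chart that contains [G].  If [H] is another noncrossing graph, [I G]
    does not occur in the expansion of [I H] in that chart, for otherwise [G] would
    lie below [H] ([has_coef_other]).  Hence all these coefficients vanish for the
    difference of [F] and the sum of the [c G * I G].  A function with this
    property is zero ([no_coef_eq0]): on the configuration
    [A_ij = x_i * y_j - y_i * x_j] the leading monomial of [A_ij] is [x_i * y_j];
    any leading monomial is that of [I G] for some noncrossing [G], and in a chart
    that contains [G] the leading monomials of the terms are distinct
    ([leads_inj]), so that [I G] must occur.  So [F] is a sum of monomials of
    noncrossing graphs, and it is one such monomial when it is extremal. *)

(** * Universal Laurent expansions *)

Section Universal.
Variable n : nat.

Implicit Types (T : {set segment n}) (K : fieldType).

(** The values of the [A_ij], [i < j], at a point where none of them vanishes. *)
Definition plucker_config K (a : 'I_n.+3 -> 'I_n.+3 -> K) : Prop :=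
  (forall i j : 'I_n.+3, (i < j)%N -> a i j != 0) /\
  (forall i j k l : 'I_n.+3, (i < j < k)%N -> (k < l)%N ->
    a i k * a j l = a i j * a k l + a i l * a j k).

Definition family := forall K : fieldType, ('I_n.+3 -> 'I_n.+3 -> K) -> K.

(** One and the same Laurent polynomial computes [f] on all configurations over
    all fields.  The flag asks for non-negative coefficients; without it the
    expansions are closed under subtraction. *)
Definition universal_laurent (pos : bool) T (f : family) : Prop :=
  exists (p : {mpoly int[#|with_edges T|]}) (m : 'X_{1..#|with_edges T|}),
    (pos -> forall e, 0 <= p@_e) /\
    forall K (a : 'I_n.+3 -> 'I_n.+3 -> K), plucker_config a ->
      f K a = poly_in a p / mmap1 (@coordinates n K a (with_edges T)) m.

Lemma poly_inXm K (a : 'I_n.+3 -> 'I_n.+3 -> K) (S : {set segment n})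
    (m : 'X_{1..#|S|}) :
  poly_in a 'X_[m] = mmap1 (@coordinates n K a S) m.
Proof. exact: mmapX. Qed.

Lemma mmap1D K (a : 'I_n.+3 -> 'I_n.+3 -> K) (S : {set segment n})
    (m m' : 'X_{1..#|S|}) :
  mmap1 (@coordinates n K a S) (m + m') =
  mmap1 (@coordinates n K a S) m * mmap1 (@coordinates n K a S) m'.
Proof. by rewrite -!poly_inXm mpolyXD /poly_in rmorphM. Qed.

Lemma mcoeff_nonneg_mul k (p q : {mpoly int[k]}) :
  (forall e, 0 <= p@_e) -> (forall e, 0 <= q@_e) -> forall e, 0 <= (p * q)@_e.
Proof.
by move=> p0 q0 e; rewrite mcoeffM; apply: sumr_ge0 => i _; apply: mulr_ge0.
Qed.

Lemma mcoeffXm_ge0 k (m : 'X_{1..k}) e : (0 : int) <= ('X_[m] : {mpoly int[k]})@_e.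
Proof. by rewrite mcoeffX; case: eqP. Qed.

Section Fixed.
Variable T : {set segment n}.
Hypothesis triT : complete_triangulation T.

Lemma config_monomial_neq0 K (a : 'I_n.+3 -> 'I_n.+3 -> K)
    (m : 'X_{1..#|with_edges T|}) :
  plucker_config a -> mmap1 (@coordinates n K a (with_edges T)) m != 0.
Proof.
move=> [a0 _]; rewrite /mmap1; apply/prodf_neq0 => k _; apply: expf_neq0.
by apply: a0; have := with_edges_segment triT (enum_valP k).
Qed.

Lemma universal_coord pos (s : segment n) : s \in with_edges T ->
  universal_laurent pos T (fun K a => a s.1 s.2).
Proof.
move=> sT; exists 'X_(enum_rank_in sT s), 0%MM; split.
  by move=> _ e; exact: mcoeffXm_ge0.
move=> K a _; rewrite poly_inXm mmap1U mmap11 divr1 /coordinates.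
by rewrite enum_rankK_in.
Qed.

Lemma universal_coordV pos (s : segment n) : s \in with_edges T ->
  universal_laurent pos T (fun K a => (a s.1 s.2)^-1).
Proof.
move=> sT; exists 1, U_(enum_rank_in sT s)%MM; split.
  by move=> _ e; rewrite mcoeff1; case: eqP.
move=> K a _; rewrite /poly_in rmorph1 mmap1U div1r /coordinates.
by rewrite enum_rankK_in.
Qed.

Lemma universalD pos (f g : family) :
  universal_laurent pos T f -> universal_laurent pos T g ->
  universal_laurent pos T (fun K a => f K a + g K a).
Proof.
move=> [p [m [p0 fE]]] [q [m' [q0 gE]]].
exists (p * 'X_[m'] + q * 'X_[m]), (m + m')%MM; split.
  move=> b e; rewrite mcoeffD.
  by apply: addr_ge0; apply: mcoeff_nonneg_mul => *;
     rewrite ?p0 ?q0 ?mcoeffXm_ge0.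
move=> K a ca; rewrite fE // gE // addf_div ?config_monomial_neq0 //.
by rewrite mmap1D /poly_in rmorphD !rmorphM /= -!/(poly_in _ _) !poly_inXm.
Qed.

Lemma universalM pos (f g : family) :
  universal_laurent pos T f -> universal_laurent pos T g ->
  universal_laurent pos T (fun K a => f K a * g K a).
Proof.
move=> [p [m [p0 fE]]] [q [m' [q0 gE]]].
exists (p * q), (m + m')%MM; split.
  by move=> b e; apply: mcoeff_nonneg_mul => *; rewrite ?p0 ?q0.
by move=> K a ca; rewrite fE // gE // mulf_div mmap1D /poly_in rmorphM.
Qed.

Lemma universal_ext pos (f g : family) :
  (forall K a, plucker_config a -> f K a = g K a) ->
  universal_laurent pos T f -> universal_laurent pos T g.
Proof.
by move=> fg [p [m [p0 fE]]]; exists p, m; split => // K a ca; rewrite -fg ?fE.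
Qed.

Lemma universal_int (pos : bool) (z : int) : (pos -> 0 <= z) ->
  universal_laurent pos T (fun K a => z%:~R).
Proof.
move=> z0; exists z%:MP, 0%MM; split.
  move=> b e; rewrite mcoeffC; apply: mulr_ge0; first exact: z0.
  by case: eqP.
by move=> K a _; rewrite mmap11 divr1 /poly_in mmapC.
Qed.

Lemma universal1 pos : universal_laurent pos T (fun K a => 1).
Proof. by apply: universal_ext (@universal_int pos 1 _). Qed.

Lemma universalX pos (f : family) e : universal_laurent pos T f ->
  universal_laurent pos T (fun K a => f K a ^+ e).
Proof.
move=> uf; elim: e => [|e IHe]; first exact: universal1.
by apply: universal_ext (universalM uf IHe) => K a _; rewrite exprS.
Qed.

Lemma universal_prod pos (I : eqType) (r : seq I) (P : pred I) (f : I -> family) :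
  (forall i, P i -> universal_laurent pos T (f i)) ->
  universal_laurent pos T (fun K a => \prod_(i <- r | P i) f i K a).
Proof.
move=> uf; elim: r => [|i r IHr].
  by apply: universal_ext (universal1 pos) => K a _; rewrite big_nil.
case Pi: (P i); last by apply: universal_ext IHr => K a _; rewrite big_cons Pi.
apply: universal_ext (universalM (uf i Pi) IHr) => K a _.
by rewrite big_cons Pi.
Qed.

Lemma universal_sum pos (I : eqType) (r : seq I) (f : I -> family) :
  (forall i, universal_laurent pos T (f i)) ->
  universal_laurent pos T (fun K a => \sum_(i <- r) f i K a).
Proof.
move=> uf; elim: r => [|i r IHr].
  by apply: universal_ext (@universal_int pos 0 _) => // K a _; rewrite big_nil.
by apply: universal_ext (universalD (uf i) IHr) => K a _; rewrite big_cons.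
Qed.

(** Cutting along the triangle of [T] that borders a segment solves the Plücker
    relation for the two segments that cross it, with only coordinates of [T]
    in the denominators and no subtraction. *)
Lemma universal_interval pos d (i j k l : 'I_n.+3) : (j - i <= d)%N ->
  (i, j) \in with_edges T -> (i <= k)%N -> (k < l)%N -> (l <= j)%N ->
  universal_laurent pos T (fun K a => a k l).
Proof.
elim: d i j k l => [|d IHd] i j k l led ijT ik kl lj; first by lia.
have [ltSij|geSij] := ltnP i.+1 j; last first.
  have -> : k = i by apply/val_inj => /=; lia.
  have -> : l = j by apply/val_inj => /=; lia.
  exact: (universal_coord pos ijT).
have [m [im mj imT mjT]] := triangle_on triT ijT ltSij.
have gl (u v : 'I_n.+3) : (i <= u)%N -> (u < v)%N -> (v <= m)%N ->
    universal_laurent pos T (fun K a => a u v).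
  by move=> *; apply: (IHd i m) => //; lia.
have gr (u v : 'I_n.+3) : (m <= u)%N -> (u < v)%N -> (v <= j)%N ->
    universal_laurent pos T (fun K a => a u v).
  by move=> *; apply: (IHd m j) => //; lia.
have gij := universal_coord pos ijT; have gim := universal_coord pos imT.
have [lm|ml] := leqP l m; first exact: gl.
have [mk|km] := leqP m k; first exact: gr.
have gil : universal_laurent pos T (fun K a => a i l).
  have [/val_inj->//|nlj] := eqVneq (l : nat) j.
  have gml : universal_laurent pos T (fun K a => a m l) by apply: gr.
  have glj : universal_laurent pos T (fun K a => a l j) by apply: gr => //; lia.
  apply: universal_ext (universalM (universalD (universalM gij gml)
    (universalM gim glj)) (universal_coordV pos mjT)) => K a [a0 pl] /=.
  apply: (mulIf (a0 _ _ mj)); rewrite divfK ?a0 // [RHS]pl ?im //; last by lia.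
  by rewrite addrC.
have [/val_inj->//|nki] := eqVneq (k : nat) i.
have gik : universal_laurent pos T (fun K a => a i k) by apply: gl; lia.
have gml : universal_laurent pos T (fun K a => a m l) by apply: gr.
have gkm : universal_laurent pos T (fun K a => a k m) by apply: gl.
apply: universal_ext (universalM (universalD (universalM gik gml)
  (universalM gil gkm)) (universal_coordV pos imT)) => K a [a0 pl] /=.
apply: (mulfI (a0 _ _ im)); rewrite mulrC divfK ?a0 // [RHS]pl //; lia.
Qed.

Lemma universal_segment pos (k l : 'I_n.+3) : (k < l)%N ->
  universal_laurent pos T (fun K a => a k l).
Proof.
move=> kl; apply: (@universal_interval pos n.+2 ord0 ord_max) => //=.
- by apply: edge_with_edges; rewrite /is_edge /is_segment /= eqxx.
by rewrite -ltnS.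
Qed.

Lemma universal_poly (S : {set segment n}) (p : {mpoly int[#|S|]}) :
  (forall s, s \in S -> is_segment s) ->
  universal_laurent false T (fun K a => poly_in a p).
Proof.
move=> sS; rewrite /poly_in /mmap; apply: universal_sum => m.
apply: universalM; first exact: universal_int.
apply: universal_prod => k _; apply: universalX; apply: universal_segment.
exact: sS (enum_valP k).
Qed.

Definition config_monomial (G : 'M[int]_n.+3) : family := fun K a =>
  \prod_(i < n.+3) \prod_(j < n.+3 | (i < j)%N) a i j ^ G i j.

(** Negative exponents occur on edges only, which are coordinates of every chart. *)
Lemma universal_monomial pos G : weighted_graph G ->
  universal_laurent pos T (config_monomial G).
Proof.
case/and3P=> _ _ /forallP dG; apply: universal_prod => i _.
apply: universal_prod => j ij.
have [ijT|ijT] := boolP (is_diagonal (i, j)).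
  have /forallP/(_ j)/implyP/(_ ijT) := dG i; case: (G i j) => // w _.
  exact/universalX/universal_segment.
have eij : (i, j) \in with_edges T.
  by apply: edge_with_edges; move: ijT; rewrite /is_diagonal /is_segment /= ij negbK.
case: (G i j) => w; first exact/universalX/universal_segment.
apply: universal_ext (universalX w.+1 (universal_coordV pos eij)) => K a _ /=.
by rewrite exprVn.
Qed.

End Fixed.

Lemma complete_triangulation_sub (S : {set segment n}) :
  noncrossing_diagonals S -> exists2 T, complete_triangulation T & S \subset T.
Proof. by move=> /maxset_exists [T TP ST]; exists T. Qed.

Lemma noncrossing_set0 : noncrossing_diagonals (set0 : {set segment n}).
Proof.
by apply/andP; split; apply/forallP => s; apply/implyP; rewrite inE.
Qed.

Section Space.
Variable X : positive_space n.

(** Every segment is a coordinate of some chart. *)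
Lemma A_neq0 (i j : 'I_n.+3) : (i < j)%N -> A X i j != 0.
Proof.
move=> ij.
have [T triT ijT] : exists2 T, complete_triangulation T & (i, j) \in with_edges T.
  have [eij|nij] := boolP (is_edge (i, j)).
    have [T triT _] := complete_triangulation_sub noncrossing_set0.
    by exists T => //; exact: edge_with_edges.
  have [|T triT ijT] := @complete_triangulation_sub [set (i, j)].
    apply/andP; split; apply/forallP => s; apply/implyP; rewrite inE => /eqP ->.
      by rewrite /is_diagonal nij andbT.
    by apply/forallP => t; apply/implyP; rewrite inE => /eqP ->; rewrite /crossing /=; lia.
  by exists T => //; rewrite inE (subsetP ijT) ?inE.
apply/eqP => A0.
have /(chart_independent triT)/(congr1 (mcoeff U_(enum_rank_in ijT (i, j)))) :
    poly_in (A X) ('X_(enum_rank_in ijT (i, j)) : {mpoly int[_]}) = 0.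
  by rewrite poly_inXm mmap1U /coordinates enum_rankK_in.
by rewrite mcoeffXU eqxx mcoeff0.
Qed.

Lemma A_config : plucker_config (A X).
Proof. by split; [exact: A_neq0|exact: plucker]. Qed.

(** The coordinates of [T] are independent on [X], so a universal expression
    that vanishes on [X] has a zero numerator. *)
Lemma transfer T (f : family) : complete_triangulation T ->
  universal_laurent false T f -> f X (A X) = 0 ->
  forall K (a : 'I_n.+3 -> 'I_n.+3 -> K), plucker_config a -> f K a = 0.
Proof.
move=> triT [p [m [_ fE]]] f0 K a ca; rewrite fE //.
have p0 : p = 0.
  apply: (@chart_independent _ X _ triT); move/eqP: f0; rewrite fE; last exact: A_config.
  rewrite mulf_eq0 invr_eq0 (negPf (config_monomial_neq0 triT _ A_config)).
  by rewrite orbF => /eqP.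
by rewrite p0 /poly_in rmorph0 mul0r.
Qed.

Lemma Lplus_universal (f : family) :
  (forall T, complete_triangulation T -> universal_laurent true T f) ->
  Lplus (f X (A X)).
Proof.
move=> uf T triT; have [p [m [p0 fE]]] := uf T triT.
by exists p, m; split; [exact: p0|exact/fE/A_config].
Qed.

Lemma Lplus_monomial G : weighted_graph G -> Lplus (graph_monomial X G).
Proof.
move=> wG; apply: (@Lplus_universal (config_monomial G)) => T triT.
exact: universal_monomial.
Qed.

End Space.

End Universal.

Arguments config_monomial {n} G {K} a.

(** * Growth of monomials along degenerating configurations *)

Section Growth.

(** This is [f t = Theta (t ^ e)] as [t] tends to infinity. *)
Definition growth (f : rat -> rat) (e : int) : Prop :=
  exists C t0 : rat, [/\ 0 < C, 0 < t0 &
    forall t, t0 <= t -> t ^ e <= C * f t /\ f t <= C * t ^ e].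

Lemma growth_ext f g e : f =1 g -> growth f e -> growth g e.
Proof. by move=> fg [C [t0 [C0 t00 H]]]; exists C, t0; split=> // t; rewrite -fg; exact: H. Qed.

Lemma growth_const c : 0 < c -> growth (fun=> c) 0.
Proof.
move=> c0; exists (c + c^-1), 1; rewrite ltr01 addr_gt0 ?invr_gt0 //; split=> // t _.
rewrite expr0z mulr1 mulrDl mulVf ?gt_eqF //.
by split; rewrite ?lerDl ?lerDr ?invr_ge0 ?mulr_ge0 ?ltW.
Qed.

Lemma growth_power e : growth (fun t => t ^ e) e.
Proof. by exists 1, 1; rewrite ltr01; split=> // t _; rewrite !mul1r lexx. Qed.

Lemma growthM f g e e' : growth f e -> growth g e' -> growth (fun t => f t * g t) (e + e').
Proof.
move=> [C [t0 [C0 t00 H]]] [C' [t0' [C0' t00' H']]].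
exists (C * C'), (Num.max t0 t0'); rewrite mulr_gt0 // lt_max t00; split=> // t.
rewrite ge_max => /andP[/[dup] tt0 /H [h1 h2] /H' [h1' h2']].
have tp : 0 < t by exact: lt_le_trans tt0.
have te z : 0 < t ^ z by rewrite exprz_gt0.
have f0 : 0 <= f t by rewrite -(pmulr_rge0 _ C0); apply: le_trans h1; exact: ltW.
have g0 : 0 <= g t by rewrite -(pmulr_rge0 _ C0'); apply: le_trans h1'; exact: ltW.
rewrite expfzDr ?gt_eqF //; split.
  by rewrite mulrACA; apply: ler_pM => //; exact: ltW.
by rewrite mulrACA; apply: ler_pM.
Qed.

Lemma growthV f e : growth f e -> growth (fun t => (f t)^-1) (- e).
Proof.
move=> [C [t0 [C0 t00 H]]]; exists C, t0; split=> // t /[dup] tt0 /H [h1 h2].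
have te : 0 < t ^ e by rewrite exprz_gt0 // (lt_le_trans t00).
have ft : 0 < f t by rewrite -(pmulr_rgt0 _ C0); apply: lt_le_trans h1.
rewrite -!invr_expz; split.
  by rewrite ler_pdivlMr // mulrC ler_pdivrMr.
by rewrite ler_pdivlMr // mulrC ler_pdivrMr.
Qed.

Lemma growthX f e (k : int) : growth f e -> growth (fun t => f t ^ k) (e * k).
Proof.
move=> gf.
have gn (m : nat) : growth (fun t => f t ^+ m) (e * m%:Z).
  elim: m => [|m IHm]; first by rewrite mulr0; exact: growth_const.
  rewrite intS mulrDr mulr1.
  by apply: growth_ext (growthM gf IHm) => t; rewrite exprS.
case: k => k; first exact: gn.
by rewrite NegzE mulrN; apply: growth_ext (growthV (gn k.+1)).
Qed.

Lemma growth_prod (I : eqType) (r : seq I) (P : pred I) (f : I -> rat -> rat)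
    (e : I -> int) : (forall i, P i -> growth (f i) (e i)) ->
  growth (fun t => \prod_(i <- r | P i) f i t) (\sum_(i <- r | P i) e i).
Proof.
move=> gf; elim: r => [|i r IHr].
  by rewrite big_nil; apply: growth_ext (growth_const ltr01) => t; rewrite big_nil.
rewrite big_cons; case Pi: (P i); last first.
  by apply: growth_ext IHr => t; rewrite big_cons Pi.
by apply: growth_ext (growthM (gf i Pi) IHr) => t; rewrite big_cons Pi.
Qed.

Lemma growth_le f g e e' : growth f e -> growth g e' ->
  (exists t1, forall t, t1 <= t -> f t <= g t) -> e <= e'.
Proof.
move=> [C [t0 [C0 t00 H]]] [C' [t0' [C0' t00' H']]] [t1 fg].
rewrite leNgt; apply/negP => ltee.
pose t := Num.max (Num.max t0 t0') (Num.max t1 (C * C' + 1)).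
have CC0 : 0 < C * C' by rewrite mulr_gt0.
have [h1 _] := H t (ltac:(by rewrite /t !le_max lexx)).
have [_ h2] := H' t (ltac:(by rewrite /t !le_max lexx !orbT)).
have h3 := fg t (ltac:(by rewrite /t !le_max lexx !orbT)).
have tC : C * C' + 1 <= t by rewrite /t !le_max lexx !orbT.
have t_gt1 : 1 <= t by apply: le_trans tC; rewrite lerDr ltW.
have t_gt0 : 0 < t by exact: lt_le_trans t_gt1.
have : t ^ e <= C * C' * t ^ e'.
  apply: le_trans h1 _; rewrite -mulrA ler_pM2l //.
  exact: le_trans h3 h2.
apply/negP; rewrite -ltNge; apply: (@lt_le_trans _ _ (t * t ^ e')).
  by rewrite ltr_pM2r ?exprz_gt0 //; apply: lt_le_trans tC; rewrite ltrDl.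
rewrite -[t in t * _]expr1z -expfzDr ?gt_eqF // ler_weXz2l //.
by rewrite addrC lezD1.
Qed.

End Growth.

Section Order.
Variables (n : nat) (X : positive_space n).

Definition det2 (K : fieldType) (u v : K * K) : K := u.1 * v.2 - u.2 * v.1.

Lemma det2_config (K : fieldType) (w : 'I_n.+3 -> K * K) :
  (forall i j : 'I_n.+3, (i < j)%N -> det2 (w i) (w j) != 0) ->
  plucker_config (fun i j => det2 (w i) (w j)).
Proof. by move=> w0; split => // i j k l _ _; rewrite /det2; ring. Qed.

Definition pairing (f : 'I_n.+3 -> 'I_n.+3 -> int) (G : 'M[int]_n.+3) : int :=
  \sum_(i < n.+3) \sum_(j < n.+3 | (i < j)%N) f i j * G i j.

(** The numerator and the denominator of the difference are positive at a positive
    configuration, and [transfer] brings the expansion there. *)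
Lemma positive_laurent_le_config T (G1 G2 : 'M[int]_n.+3)
    (a : 'I_n.+3 -> 'I_n.+3 -> rat) :
  complete_triangulation T -> weighted_graph G1 -> weighted_graph G2 ->
  positive_laurent (A X) (with_edges T) (graph_monomial X G2 - graph_monomial X G1) ->
  plucker_config a -> (forall i j : 'I_n.+3, (i < j)%N -> 0 < a i j) ->
  config_monomial G1 a <= config_monomial G2 a.
Proof.
move=> triT wG1 wG2 [p [m [p0 FE]]] ca a0.
have segT s : s \in with_edges T -> is_segment s := @with_edges_segment _ _ triT s.
have m_gt0 (e : 'X_{1..#|with_edges T|}) : 0 < mmap1 (coordinates a (S := _)) e.
  by apply: prodr_gt0 => k _; apply/exprn_gt0/a0; exact: segT (enum_valP k).
pose f (K : fieldType) (b : 'I_n.+3 -> 'I_n.+3 -> K) :=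
  (config_monomial G2 b + (-1)%:~R * config_monomial G1 b) *
    poly_in b ('X_[m] : {mpoly int[#|with_edges T|]}) + (-1)%:~R * poly_in b p.
have uf : universal_laurent false T f.
  have uN : universal_laurent false T (fun K a => (-1)%:~R) by exact: universal_int.
  by do ![exact: universal_monomial|exact: universal_poly|exact: uN|
          apply: (universalD triT)|apply: universalM].
have /(transfer triT uf)/(_ _ _ ca)/eqP : f X (A X) = 0.
  rewrite /f !mulN1r.
  rewrite -/(graph_monomial X G1) -/(graph_monomial X G2) FE poly_inXm divfK ?subrr //.
  exact: (config_monomial_neq0 triT _ (A_config X)).
rewrite /f !mulN1r subr_eq0 => /eqP fE.
rewrite -subr_ge0 -(pmulr_lge0 _ (m_gt0 m)) -poly_inXm fE.
apply: sumr_ge0 => e _; rewrite mulr_ge0 ?ler0z //; exact/ltW/m_gt0.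
Qed.

(** Along a degeneration of positive configurations the larger monomial grows at
    least as fast, and the rate of growth of [I G] is linear in [G]. *)
Lemma positive_laurent_degree T (G1 G2 : 'M[int]_n.+3)
    (w : rat -> 'I_n.+3 -> rat * rat) (e : 'I_n.+3 -> 'I_n.+3 -> int) :
  complete_triangulation T -> weighted_graph G1 -> weighted_graph G2 ->
  positive_laurent (A X) (with_edges T) (graph_monomial X G2 - graph_monomial X G1) ->
  (exists t0, forall t, t0 <= t ->
     forall i j : 'I_n.+3, (i < j)%N -> 0 < det2 (w t i) (w t j)) ->
  (forall i j : 'I_n.+3, (i < j)%N -> growth (fun t => det2 (w t i) (w t j)) (e i j)) ->
  pairing e G1 <= pairing e G2.
Proof.
move=> triT wG1 wG2 FE [t0 wpos] wg.
pose a t (i j : 'I_n.+3) := det2 (w t i) (w t j).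
have gG (G : 'M[int]_n.+3) : growth (fun t => config_monomial G (a t))
    (pairing e G).
  by apply: growth_prod => i _; apply: growth_prod => j ij; apply/growthX/wg.
apply: (growth_le (gG G1) (gG G2)); exists t0 => t /wpos at0.
apply: (positive_laurent_le_config triT) => //.
by apply: det2_config => i j ij; rewrite gt_eqF ?at0.
Qed.

Lemma pairing_full (f : 'I_n.+3 -> 'I_n.+3 -> int) (G : 'M[int]_n.+3) :
  G^T = G -> (forall i, G i i = 0) ->
  pairing (fun i j => f i j + f j i) G =
  \sum_(i < n.+3) \sum_(j < n.+3) f i j * G i j.
Proof.
move=> Gsym G0; rewrite /pairing.
have GC i j : G j i = G i j by rewrite -{1}Gsym mxE.
under eq_bigr do (under eq_bigr do rewrite mulrDl); under eq_bigr do rewrite big_split.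
rewrite big_split /=.
have -> : \sum_(i < n.+3) \sum_(j < n.+3 | (i < j)%N) f j i * G i j =
          \sum_(i < n.+3) \sum_(j < n.+3 | (j < i)%N) f i j * G i j.
  rewrite (exchange_big_dep predT) //=; apply: eq_bigr => i _.
  by apply: eq_bigr => j _; rewrite GC.
rewrite -big_split; apply: eq_bigr => i _ /=.
rewrite [RHS](bigID (fun j : 'I_n.+3 => (i < j)%N)) /=; congr (_ + _).
rewrite [RHS](bigD1 i) ?ltnn //= G0 mulr0 add0r.
apply: eq_bigl => j; rewrite -leqNgt ltn_neqAle andbC; congr (_ && _).
Qed.

Lemma weighted_sym (G : 'M[int]_n.+3) : weighted_graph G -> G^T = G.
Proof. by case/and3P=> /eqP. Qed.

Lemma weighted_diag (G : 'M[int]_n.+3) : weighted_graph G -> forall i, G i i = 0.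
Proof. by case/and3P=> _ /forallP G0 _ i; apply/eqP. Qed.

Lemma vertex_weight_pairing p (G : 'M[int]_n.+3) :
  G^T = G -> (forall i, G i i = 0) ->
  vertex_weight p G = pairing (fun i j => (i == p)%:R + (j == p)%:R) G.
Proof.
move=> Gs G0; rewrite (pairing_full (fun i _ => (i == p)%:R)) //.
rewrite (bigD1 p) //= [X in _ = _ + X]big1 ?addr0.
  by rewrite eqxx /vertex_weight; apply: eq_bigr => j _; rewrite mul1r.
by move=> i /negPf ->; rewrite big1 // => j _; rewrite mul0r.
Qed.

(** The gap [a] lies between the vertices [a] and [a + 1], modulo [n + 3].  The
    parity tells whether the ends of [(i, j)] lie on different sides of the line
    that joins the gaps [a] and [b]; in this form it is symmetric in [a] and [b]. *)
Definition separates (a b i j : nat) : bool :=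
  ((i <= a) (+) (j <= a) (+) (i <= b) (+) (j <= b))%N.

Lemma cut_weight_pairing (k l : 'I_n.+3) (G : 'M[int]_n.+3) :
  G^T = G -> (forall i, G i i = 0) -> (k < l)%N ->
  cut_weight k l G = pairing (fun i j => (separates k l i j)%:R) G.
Proof.
move=> Gs G0 kl; pose f (i j : 'I_n.+3) : int := ((k < i <= l) && ~~ (k < j <= l))%N%:R.
transitivity (pairing (fun i j => f i j + f j i) G).
  rewrite pairing_full // /cut_weight big_mkcond; apply: eq_bigr => i _.
  rewrite /f; case: (k < i <= l)%N; last by rewrite big1 // => j _; rewrite mul0r.
  by rewrite big_mkcond; apply: eq_bigr => j _ /=; case: ifP; rewrite ?mul1r ?mul0r.
apply: eq_bigr => i _; apply: eq_bigr => j _; congr (_ * _).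
rewrite /f /separates; case: (leqP i k) => ik; case: (leqP i l) => il;
  case: (leqP j k) => jk; case: (leqP j l) => jl //=; lia.
Qed.

Lemma positive_laurent_vertex T (G1 G2 : 'M[int]_n.+3) p :
  complete_triangulation T -> weighted_graph G1 -> weighted_graph G2 ->
  positive_laurent (A X) (with_edges T) (graph_monomial X G2 - graph_monomial X G1) ->
  vertex_weight p G1 = vertex_weight p G2.
Proof.
move=> triT wG1 wG2 FE.
(* The vector at p grows when s = 1 and shrinks when s = -1. *)
have scale (s : int) : s * vertex_weight p G1 <= s * vertex_weight p G2.
  pose c (i : 'I_n.+3) : int := s * (i == p)%:R.
  have sumc G : weighted_graph G -> s * vertex_weight p G =
      pairing (fun i j => c i + c j) G.
    move=> wG; rewrite vertex_weight_pairing ?weighted_sym //; last exact: weighted_diag.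
    rewrite /pairing mulr_sumr; apply: eq_bigr => i _; rewrite mulr_sumr.
    by apply: eq_bigr => j _; rewrite mulrA mulrDr.
  rewrite !sumc //.
  pose w (t : rat) (i : 'I_n.+3) : rat * rat := (t ^ c i, t ^ c i * i%:R).
  have detE t i j : det2 (w t i) (w t j) = t ^ c i * t ^ c j * (j%:R - i%:R).
    by rewrite /det2 /w /=; ring.
  apply: (positive_laurent_degree (w := w) triT) => //.
    exists 1 => t t1 i j ij; have t0 : 0 < t by exact: lt_le_trans t1.
    by rewrite detE !mulr_gt0 ?exprz_gt0 // subr_gt0 ltr_nat.
  move=> i j ij; apply: growth_ext (fun t => esym (detE t i j)) _.
  have ij0 : 0 < j%:R - i%:R :> rat by rewrite subr_gt0 ltr_nat.
  rewrite -[c i + c j]addr0.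
  exact: growthM (growthM (growth_power _) (growth_power _)) (growth_const ij0).
by have := scale 1; have := scale (-1); rewrite !mulN1r !mul1r lerN2 => ? ?; apply/le_anti/andP.
Qed.

(** When the vectors of the vertices [k+1, ..., l] move far away from the others,
    the determinants across grow linearly, while all others stay constant. *)
Lemma positive_laurent_cut T (G1 G2 : 'M[int]_n.+3) (k l : 'I_n.+3) :
  complete_triangulation T -> weighted_graph G1 -> weighted_graph G2 ->
  positive_laurent (A X) (with_edges T) (graph_monomial X G2 - graph_monomial X G1) ->
  (k < l)%N -> cut_weight k l G1 <= cut_weight k l G2.
Proof.
move=> triT wG1 wG2 FE kl.
rewrite !cut_weight_pairing ?weighted_sym //; try exact: weighted_diag.
pose f (i j : 'I_n.+3) : int := (separates k l i j)%:R.
(* These vectors turn counterclockwise: the outer ones do not depend on t, while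
   those of k+1, ..., l tend to infinity in the direction (0, 1), with mutual
   determinants that do not depend on t. *)
pose w (t : rat) (i : 'I_n.+3) : rat * rat :=
  if (i <= k)%N then (1, i.+1%:R) else
  if (i <= l)%N then (- i.+1%:R / t, t) else (-1, (n.+4 - i)%:R).
pose N : rat := n.+4%:R.
have N1 : 1 <= N by rewrite ler1n.
have small (i : 'I_n.+3) : 1 <= i.+1%:R :> rat /\ i.+1%:R <= N.
  by rewrite ler1n ler_nat; split => //; have := ltn_ord i; lia.
have small' (i : 'I_n.+3) : 1 <= (n.+4 - i)%:R :> rat /\ (n.+4 - i)%:R <= N.
  by rewrite ler1n ler_nat; split => //; have := ltn_ord i; lia.
have natS (i : 'I_n.+3) : (n.+4 - i)%:R = N - i%:R :> rat.
  by rewrite natrB // ltnW // ltnS ltnW.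
have far (x y t : rat) : 1 <= x -> x <= N -> 1 <= y -> y <= N -> 2 * N ^+ 2 <= t ->
    - t / 2 <= x * y / t <= t / 2.
  move=> x1 xN y1 yN tN; have N0 : 0 < N by exact: lt_le_trans N1.
  have t0 : 0 < t by nra.
  have xy : 0 <= x * y <= N ^+ 2 by nra.
  have xyt0 : 0 <= x * y / t by rewrite divr_ge0 ?(ltW t0) //; nra.
  have t_ge1 : 1 <= t by nra.
  have : x * y / t <= N ^+ 2 by rewrite ler_pdivrMr //; nra.
  by lra.
have near (i j : 'I_n.+3) (t : rat) : (i < j)%N -> 0 < t -> f i j = 0 ->
    1 <= det2 (w t i) (w t j) <= 2 * N.
  move=> ij t0; rewrite /f /separates /w /det2 natS natS.
  have ijR : i%:R + 1 <= j%:R :> rat by rewrite natr1 ler_nat.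
  have jN : j%:R <= N :> rat by rewrite ler_nat; have := ltn_ord j; lia.
  have i0 : 0 <= i%:R :> rat by [].
  have tt : t != 0 by rewrite gt_eqF.
  have nS (x : 'I_n.+3) : x.+1%:R = x%:R + 1 :> rat by rewrite -natr1.
  case: (leqP i k) => ik; case: (leqP j k) => jk; case: (leqP i l) => il;
    case: (leqP j l) => jl //= _; rewrite ?nS; try (exfalso; move: ij kl ik jk il jl; clear; lia);
    try by lra.
  by rewrite [t * _]mulrC !divfK //; lra.
have cross (i j : 'I_n.+3) (t : rat) : (i < j)%N -> 2 * N ^+ 2 <= t -> f i j = 1 ->
    t / 2 <= det2 (w t i) (w t j) <= 2 * t.
  move=> ij tN; rewrite /f /separates /w /det2.
  have [i1 iN] := small i; have [j1 jN] := small j.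
  have [i1' iN'] := small' i; have [j1' jN'] := small' j.
  have f1 := far _ _ _ i1 iN j1 jN tN; have f2 := far _ _ _ i1 iN j1' jN' tN.
  have t0 : 0 <= t by nra.
  case: (leqP i k) => ik; case: (leqP j k) => jk; case: (leqP i l) => il;
    case: (leqP j l) => jl //= _; try (exfalso; move: ij kl ik jk il jl; clear; lia);
    move: f1 f2; lra.
have f01 (i j : 'I_n.+3) : f i j = 0 \/ f i j = 1.
  by rewrite /f; case: separates; [right|left].
have big_t (t : rat) : 2 * N ^+ 2 <= t -> 1 <= t by move=> ?; nra.
apply: (positive_laurent_degree (w := w) triT) => //.
  exists (2 * N ^+ 2) => t tN i j ij; have t1 := big_t t tN.
  case: (f01 i j) => fij; first by have := near i j t ij _ fij; lra.
  by have := cross i j t ij tN fij; lra.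
move=> i j ij; rewrite -/(f i j); case: (f01 i j) => fij; rewrite fij.
  exists (2 * N), 1; split=> [||t t1] //; first lra.
  have := near i j t ij (lt_le_trans ltr01 t1) fij; rewrite expr0z; nra.
exists 2, (2 * N ^+ 2); split=> [||t tN] //; first nra.
by have := cross i j t ij tN fij; rewrite expr1z; lra.
Qed.

End Order.

(** * Resolving the crossings of a weighted graph *)

Section Resolution.
Variable n : nat.
Implicit Types (G : 'M[int]_n.+3) (f : 'I_n.+3 -> 'I_n.+3 -> int).

Definition one_segment (i j : 'I_n.+3) : 'M[int]_n.+3 := delta_mx i j + delta_mx j i.

Lemma one_segmentE i j x y :
  one_segment i j x y = ((x == i) && (y == j))%:R + ((x == j) && (y == i))%:R.
Proof. by rewrite !mxE. Qed.

Lemma one_segment_sym i j : (one_segment i j)^T = one_segment i j.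
Proof. by rewrite /one_segment linearD /= !trmx_delta addrC. Qed.

Lemma pairingD f G H : pairing f (G + H) = pairing f G + pairing f H.
Proof.
rewrite /pairing -big_split; apply: eq_bigr => i _; rewrite -big_split.
by apply: eq_bigr => j _; rewrite mxE mulrDr.
Qed.

Lemma pairingN f G : pairing f (- G) = - pairing f G.
Proof.
rewrite /pairing -sumrN; apply: eq_bigr => i _; rewrite -sumrN.
by apply: eq_bigr => j _; rewrite mxE mulrN.
Qed.

Lemma pairing_one_segment f (i j : 'I_n.+3) : (i < j)%N ->
  pairing f (one_segment i j) = f i j.
Proof.
move=> ij; have nji x y : (x < y)%N -> (x == j) && (y == i) = false.
  by move=> xy; apply/negP => /andP[/eqP ? /eqP ?]; subst; lia.
rewrite /pairing (bigD1 i) //= [X in _ + X]big1 => [|x xi]; last first.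
  by rewrite big1 // => y xy; rewrite one_segmentE (negPf xi) nji // mulr0.
rewrite (bigD1 j) //= [X in _ + X + _]big1 => [|y /andP[xy yj]]; last first.
  by rewrite one_segmentE (negPf yj) nji // andbF mulr0.
by rewrite one_segmentE !eqxx nji // mulr1 !addr0.
Qed.

Section Monomials.
Variables (K : fieldType) (a : 'I_n.+3 -> 'I_n.+3 -> K).
Hypothesis ca : plucker_config a.

Lemma config_monomialD G H :
  config_monomial (G + H) a = config_monomial G a * config_monomial H a.
Proof.
rewrite /config_monomial -big_split; apply: eq_bigr => i _; rewrite -big_split.
by apply: eq_bigr => j ij; rewrite mxE expfzDr // (proj1 ca).
Qed.

Lemma config_monomial0 : config_monomial 0 a = 1.
Proof. by rewrite /config_monomial big1 // => i _; rewrite big1 // => j _; rewrite mxE. Qed.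

Lemma config_monomial_one_segment (i j : 'I_n.+3) : (i < j)%N ->
  config_monomial (one_segment i j) a = a i j.
Proof.
move=> ij; have nji x y : (x < y)%N -> (x == j) && (y == i) = false.
  by move=> xy; apply/negP => /andP[/eqP ? /eqP ?]; subst; lia.
rewrite /config_monomial (bigD1 i) //= [X in _ * X]big1 => [|x xi]; last first.
  by rewrite big1 // => y xy; rewrite one_segmentE (negPf xi) nji.
rewrite (bigD1 j) //= [X in _ * X * _]big1 => [|y /andP[xy yj]]; last first.
  by rewrite one_segmentE (negPf yj) nji // andbF.
by rewrite one_segmentE !eqxx nji // !mulr1.
Qed.

End Monomials.

Lemma weighted_one_segment (i j : 'I_n.+3) : i != j -> weighted_graph (one_segment i j).
Proof.
move=> ij; apply/and3P; split.
- exact/eqP/one_segment_sym.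
- apply/forallP => x; rewrite one_segmentE andbC; case: (x =P j) => [->|_] //=.
  by rewrite ?[j == i]eq_sym (negPf ij).
by apply/forallP => x; apply/forallP => y; rewrite one_segmentE addr_ge0 ?implybT.
Qed.

Lemma weightedD G H : weighted_graph G -> weighted_graph H -> weighted_graph (G + H).
Proof.
move=> /and3P[/eqP Gs /forallP G0 /forallP Gd] /and3P[/eqP Hs /forallP H0 /forallP Hd].
apply/and3P; split; first by rewrite linearD /= Gs Hs.
  by apply/forallP => i; rewrite mxE (eqP (G0 i)) (eqP (H0 i)).
apply/forallP => i; apply/forallP => j; apply/implyP => d; rewrite mxE.
have /forallP/(_ j)/implyP/(_ d) Gij := Gd i.
have /forallP/(_ j)/implyP/(_ d) Hij := Hd i.
exact: addr_ge0.
Qed.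

Lemma weightedP G : reflect [/\ G^T = G, forall i, G i i = 0 &
  forall i j : 'I_n.+3, is_diagonal (i, j) -> 0 <= G i j] (weighted_graph G).
Proof.
apply: (iffP and3P) => [[/eqP Gs /forallP G0 /forallP Gd]|[Gs G0 Gd]]; split => //.
- by move=> i; apply/eqP.
- by move=> i j; have /forallP/(_ j)/implyP := Gd i.
- exact/eqP.
- by apply/forallP => i; apply/eqP.
- by apply/forallP => i; apply/forallP => j; apply/implyP/Gd.
Qed.

Definition resolution G (i k j l p q r s : 'I_n.+3) : 'M[int]_n.+3 :=
  G - one_segment i k - one_segment j l + one_segment p q + one_segment r s.

Lemma pairing_resolution f G i k j l p q r s :
  pairing f (resolution G i k j l p q r s) =
  pairing f G - pairing f (one_segment i k) - pairing f (one_segment j l)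
    + pairing f (one_segment p q) + pairing f (one_segment r s).
Proof.
rewrite /resolution; move: (one_segment i k) (one_segment j l) (one_segment p q)
  (one_segment r s) => E1 E2 E3 E4.
by rewrite !(pairingD, pairingN).
Qed.

Section Crossing.
Variables (G : 'M[int]_n.+3) (i j k l : 'I_n.+3).
Hypotheses (wG : weighted_graph G) (ijkl : (i < j < k)%N) (kl : (k < l)%N).
Hypotheses (Gik : 0 < G i k) (Gjl : 0 < G j l).

Lemma weighted_resolution (p q r s : 'I_n.+3) : p != q -> r != s ->
  weighted_graph (resolution G i k j l p q r s).
Proof.
move=> pq rs; apply: weightedD; last exact: weighted_one_segment.
apply: weightedD; last exact: weighted_one_segment.
have [Gs G0 Gd] := weightedP _ wG.
have d0 (x y z : 'I_n.+3) : (x < y)%N -> one_segment x y z z = 0.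
  move=> xy; rewrite one_segmentE andbC; case: (z =P y) => [->|_] //=.
  by rewrite -val_eqE /= gtn_eqF.
have entry x y : (G - one_segment i k - one_segment j l) x y =
    G x y - one_segment i k x y - one_segment j l x y by rewrite !mxE.
have [ij jk] := andP ijkl.
apply/weightedP; split.
- by rewrite !linearB /= Gs !one_segment_sym.
- by move=> x; rewrite entry G0 !d0 ?subr0 ?(ltn_trans ij jk) ?(ltn_trans jk kl).
move=> x y /[dup] dxy /Gd; rewrite entry !one_segmentE; have /andP[xy _] := dxy; rewrite /is_segment /= in xy.
have off (p' q' : 'I_n.+3) : (p' < q')%N -> (x == q') && (y == p') = false.
  by move=> pq'; apply/negP => /andP[/eqP ? /eqP ?]; subst; lia.
rewrite (off _ _ (ltn_trans ij jk)) (off _ _ (ltn_trans jk kl)) !addr0.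
case: (boolP ((x == i) && (y == k))) => [/andP[/eqP-> /eqP->] _|_ Gxy].
  by rewrite -(inj_eq val_inj) (ltn_eqF ij) subr0 subr_ge0 -gtz0_ge1.
rewrite subr0; case: (boolP ((x == j) && (y == l))) => [/andP[/eqP-> /eqP->]|_].
  by rewrite subr_ge0 -gtz0_ge1.
by rewrite subr0.
Qed.

Let ij : (i < j)%N. Proof. by case/andP: ijkl. Qed.
Let jk : (j < k)%N. Proof. by case/andP: ijkl. Qed.
Let ik : (i < k)%N. Proof. exact: ltn_trans ij jk. Qed.
Let jl : (j < l)%N. Proof. exact: ltn_trans jk kl. Qed.
Let il : (i < l)%N. Proof. exact: ltn_trans ij jl. Qed.

Definition resolve_outer := resolution G i k j l i l j k.
Definition resolve_inner := resolution G i k j l i j k l.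

Lemma neq_lt (p q : 'I_n.+3) : (p < q)%N -> p != q.
Proof. by move=> pq; rewrite -(inj_eq val_inj) (ltn_eqF pq). Qed.

Lemma weighted_outer : weighted_graph resolve_outer.
Proof. by apply: weighted_resolution; exact: neq_lt. Qed.

Lemma weighted_inner : weighted_graph resolve_inner.
Proof. by apply: weighted_resolution; exact: neq_lt. Qed.

Lemma pairing_outer f :
  pairing f resolve_outer = pairing f G - f i k - f j l + f i l + f j k.
Proof. by rewrite pairing_resolution ?pairing_one_segment. Qed.

Lemma pairing_inner f :
  pairing f resolve_inner = pairing f G - f i k - f j l + f i j + f k l.
Proof. by rewrite pairing_resolution ?pairing_one_segment. Qed.

Lemma config_monomial_resolve (K : fieldType) (a : 'I_n.+3 -> 'I_n.+3 -> K) :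
  plucker_config a -> config_monomial G a =
    config_monomial resolve_inner a + config_monomial resolve_outer a.
Proof.
move=> ca; pose B := G - one_segment i k - one_segment j l.
have -> : G = B + one_segment i k + one_segment j l by rewrite /B addrAC !subrK.
have cmB (p q r s : 'I_n.+3) : (p < q)%N -> (r < s)%N ->
    config_monomial (B + one_segment p q + one_segment r s) a =
    config_monomial B a * (a p q * a r s).
  move=> pq rs; rewrite (config_monomialD ca (B + _)) (config_monomialD ca B).
  by rewrite !(config_monomial_one_segment a) // mulrA.
by rewrite !cmB // -mulrDr (proj2 ca).
Qed.

(** Up to an additive constant, the length of a segment times that of its
    complement: it vanishes on the edges, and drops in both resolutions of a
    crossing because it is strictly concave. *)
Definition chord (i j : 'I_n.+3) : int :=
  (j%:Z - i%:Z - 1) * (n.+2%:Z - (j%:Z - i%:Z)).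

End Crossing.

Definition size_graph G := `|pairing chord G|%N.

Lemma pairing_chord_ge0 G : weighted_graph G -> 0 <= pairing chord G.
Proof.
move=> /weightedP[_ _ Gd]; apply: sumr_ge0 => i _; apply: sumr_ge0 => j ij.
have [d|] := boolP (is_diagonal (i, j)).
  apply: mulr_ge0; last exact: Gd.
  have := ltn_ord j; rewrite /chord => jn; apply: mulr_ge0; lia.
rewrite /is_diagonal /is_edge /is_segment /= ij /= negbK => /orP[/eqP ji|/andP[/eqP i0 /eqP jn]].
  by rewrite /chord ji (_ : _ - 1 = 0) ?mul0r //; lia.
by rewrite /chord i0 jn (_ : _ - (_ - _) = 0) ?mulr0 ?mul0r //; lia.
Qed.

Lemma size_resolve (G : 'M[int]_n.+3) (i j k l : 'I_n.+3) : weighted_graph G ->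
  (i < j < k)%N -> (k < l)%N -> 0 < G i k -> 0 < G j l ->
  (size_graph (resolve_outer G i j k l) < size_graph G)%N /\
  (size_graph (resolve_inner G i j k l) < size_graph G)%N.
Proof.
move=> wG ijk kl Gik Gjl.
have g0 := pairing_chord_ge0 wG.
have o0 := pairing_chord_ge0 (weighted_outer wG ijk kl Gik Gjl).
have i0 := pairing_chord_ge0 (weighted_inner wG ijk kl Gik Gjl).
rewrite -!ltz_nat /size_graph !gez0_abs // pairing_outer // pairing_inner //.
case/andP: ijk => ij jk; have ln := ltn_ord l; rewrite /chord.
move: (pairing _ _) (nat_of_ord i) (nat_of_ord j) (nat_of_ord k) (nat_of_ord l) ij jk kl ln.
clear; move=> g i j k l ij jk kl ln.
have {}ij : i%:Z + 1 <= j%:Z by lia.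
have {}jk : j%:Z + 1 <= k%:Z by lia.
have {}kl : k%:Z + 1 <= l%:Z by lia.
have {}ln : l%:Z <= n.+2%:Z by lia.
have i0 : 0 <= i%:Z by [].
by move: (i%:Z) (j%:Z) (k%:Z) (l%:Z) (n.+2%:Z) ij jk kl ln i0 => a b c d e ? ? ? ? ?; split; nia.
Qed.

End Resolution.

(** * The cut inequalities force a resolvable crossing *)

Section Corner.

Lemma telescope2 (D : nat -> nat -> int) p q r : (q <= r)%N ->
  \sum_(q <= y < r) \sum_(0 <= x < p)
    (D x y + D x.+1 y.+1 - D x.+1 y - D x y.+1) = D 0%N q + D p r - D p q - D 0%N r.
Proof.
move=> qr; pose g y := D p y - D 0%N y.
rewrite (eq_bigr (fun y => g y.+1 - g y)) => [|y _]; last first.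
  rewrite (eq_bigr (fun x => (D x.+1 y.+1 - D x.+1 y) - (D x y.+1 - D x y))).
    by rewrite telescope_sumr // /g; ring.
  by move=> x _; ring.
by rewrite telescope_sumr // /g; ring.
Qed.

(** [D] is positive at the origin and vanishes somewhere on both axes.  Take the
    positive initial part of the axis [x = 0], of height [y], and the largest width
    [h] on which all rows up to [y] stay positive, so that a row [y'] ends at [h].
    The mixed differences over the columns up to [h] and the rows from [y'] to [y]
    add up to [D 0 y' + D h.+1 y.+1], as the other two corners vanish; one of them
    is positive. *)
Lemma corner (D : nat -> nat -> int) x0 y0 : (forall x y, 0 <= D x y) ->
  0 < D 0%N 0%N -> D x0 0%N = 0 -> D 0%N y0 = 0 ->
  exists x y, (forall x' y', (x' <= x)%N -> (y' <= y)%N -> 0 < D x' y') /\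
    0 < D x y + D x.+1 y.+1 - D x.+1 y - D x y.+1.
Proof.
move=> D_ge0 D00 Dx0 Dy0.
have exy : exists y, D 0%N y.+1 == 0.
  by exists y0.-1; case: y0 Dy0 => [D0|y0 /eqP //]; rewrite D0 in D00.
have [y /eqP y1 ymin] := ex_minnP exy.
have col y' : (y' <= y)%N -> 0 < D 0%N y'.
  case: y' => [//|y'] y'y; rewrite lt_neqAle D_ge0 andbT eq_sym.
  by apply: contraTneq y'y => /eqP/ymin; rewrite -leqNgt.
have exh : exists h, has (fun y' => D h.+1 y' == 0) (iota 0 y.+1).
  exists x0.-1; apply/hasP; exists 0%N; rewrite ?mem_iota //.
  case: x0 Dx0 => [D0|x0 /eqP //]; first by rewrite D0 in D00.
have [h /hasP[y' +] /eqP hy' hmin] := ex_minnP exh.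
rewrite mem_iota /= add0n ltnS => y'y.
have rect x z : (x <= h)%N -> (z <= y)%N -> 0 < D x z.
  case: x => [_|x xh zy]; first exact: col.
  rewrite lt_neqAle D_ge0 andbT eq_sym; apply: contraTneq xh => Dxz.
  rewrite -leqNgt; apply: hmin; apply/hasP; exists z; rewrite ?mem_iota ?add0n ?ltnS //.
  exact/eqP.
pose M x z := D x z + D x.+1 z.+1 - D x.+1 z - D x z.+1.
have Msum : 0 < \sum_(y' <= z < y.+1) \sum_(0 <= x < h.+1) M x z.
  rewrite telescope2 ?(leqW y'y) // hy' y1 !subr0.
  by apply: ltr_pwDl; [exact: col|exact: D_ge0].
have [/hasP[z zr /hasP[x xr Mxz]]|nM] :=
    boolP (has (fun z => has (fun x => 0 < M x z) (index_iota 0 h.+1)) (index_iota y' y.+1)).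
  exists x, z; split; last exact: Mxz.
  move: zr xr; rewrite !mem_index_iota /= !ltnS => /andP[_ zy] xh x' z' x'x z'z.
  by apply: rect; [exact: leq_trans xh|exact: leq_trans zy].
exfalso; move: Msum; apply/negP; rewrite -leNgt big_seq; apply: sumr_le0 => z zr.
rewrite big_seq; apply: sumr_le0 => x xr; rewrite leNgt; apply/negP => Mxz.
by case/negP: nM; apply/hasP; exists z => //; apply/hasP; exists x.
Qed.

End Corner.

Section Cuts.
Variable n : nat.
Implicit Types (G : 'M[int]_n.+3).
Local Notation N := n.+3.

Definition vertex_of (u : nat) : 'I_N := inord (u %% N).

Lemma vertex_ofE u : vertex_of u = (u %% N)%N :> nat.
Proof. by rewrite inordK // ltn_mod. Qed.

Definition cut (G : 'M[int]_N) (a b : nat) : int :=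
  pairing (fun i j => (separates (a %% N) (b %% N) i j)%:R) G.

Lemma separates_sym a b i j : separates a b i j = separates b a i j.
Proof. by rewrite /separates -addbA addbC addbA. Qed.

Lemma cut_sym G a b : cut G a b = cut G b a.
Proof.
by apply: eq_bigr => i _; apply: eq_bigr => j _; rewrite separates_sym.
Qed.

Lemma cut_mod G a a' b b' : a = a' %[mod N] -> b = b' %[mod N] -> cut G a b = cut G a' b'.
Proof. by rewrite /cut => -> ->. Qed.

Lemma pairing_ext (f g : 'I_N -> 'I_N -> int) G :
  (forall i j : 'I_N, (i < j)%N -> f i j = g i j) -> pairing f G = pairing g G.
Proof. by move=> fg; apply: eq_bigr => i _; apply: eq_bigr => j ij; rewrite fg. Qed.

Lemma pairing_linear (f g h k : 'I_N -> 'I_N -> int) G :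
  pairing f G + pairing g G - pairing h G - pairing k G =
  pairing (fun i j => f i j + g i j - h i j - k i j) G.
Proof.
rewrite /pairing -big_split -!sumrB; apply: eq_bigr => i _.
by rewrite -big_split -!sumrB; apply: eq_bigr => j _ /=; ring.
Qed.

Lemma separates_mixed M (a b i j u v : nat) : (a < M)%N -> (b < M)%N -> (i < j < M)%N ->
  u = (if a.+1 == M then 0 else a.+1)%N -> v = (if b.+1 == M then 0 else b.+1)%N ->
  u <> v ->
  (separates a b i j)%:R + (separates u v i j)%:R - (separates u b i j)%:R
    - (separates a v i j)%:R =
  2 * (((i == u) && (j == v))%:R + ((i == v) && (j == u))%:R) :> int.
Proof.
move=> aM bM /andP[ij jM] uE vE uv; rewrite /separates.
case: (eqVneq a.+1 M) uE => aE uE; case: (eqVneq b.+1 M) vE => bE vE; subst u v; lia.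
Qed.

(** Both resolutions of a crossing keep the cuts, except that they lose two
    segments between the gaps of two opposite sides of the quadrilateral: those
    below [(i, j)] and [(k, l)] for one resolution, the other two sides for the
    other. *)
Lemma separates_outer (c d i j k l : nat) : (i < j < k)%N -> (k < l)%N ->
  (separates c d i k)%:R + (separates c d j l)%:R - (separates c d i l)%:R
    - (separates c d j k)%:R =
  2 * ((i <= c < j) && (k <= d < l) || (i <= d < j) && (k <= c < l))%N%:R :> int.
Proof. by rewrite /separates; lia. Qed.

Lemma separates_inner (c d i j k l : nat) : (i < j < k)%N -> (k < l)%N ->
  (separates c d i k)%:R + (separates c d j l)%:R - (separates c d i j)%:R
    - (separates c d k l)%:R =
  2 * ((j <= c < k) && ((l <= d) || (d < i)) ||
       (j <= d < k) && ((l <= c) || (c < i)))%N%:R :> int.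
Proof. by rewrite /separates; lia. Qed.

Lemma modn_succ a : (a.+1 %% N = if (a %% N).+1 == N then 0 else (a %% N).+1)%N.
Proof.
rewrite -addn1 -modnDml addn1; case: eqP => [->|ne]; first by rewrite modnn.
by rewrite modn_small //; have := ltn_pmod a (ltn0Sn n.+2); lia.
Qed.

(** Passing the vertices [a + 1] and [b + 1] changes the side of these two only,
    so the mixed difference counts the segment that joins them, twice. *)
Lemma cut_mixed G a b : G^T = G -> a.+1 <> b.+1 %[mod N] ->
  cut G a b + cut G a.+1 b.+1 - cut G a.+1 b - cut G a b.+1 =
  2 * G (vertex_of a.+1) (vertex_of b.+1).
Proof.
move=> Gs ab; set u := vertex_of a.+1; set v := vertex_of b.+1.
have uv : u != v by apply/eqP => /(congr1 val); rewrite /= !vertex_ofE.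
rewrite /cut pairing_linear.
transitivity (pairing (fun i j => 2 * one_segment u v i j) G).
  apply: pairing_ext => i j ij; rewrite one_segmentE -!(inj_eq val_inj) /= !vertex_ofE.
  apply: (@separates_mixed N); rewrite ?modn_succ ?ltn_mod ?ltn_ord ?ij //.
  by move: ab; rewrite !modn_succ.
have pG (x y : 'I_N) : (x < y)%N ->
    pairing (fun i j => 2 * one_segment x y i j) G = 2 * G x y.
  move=> xy; rewrite -(pairing_one_segment (fun i j => G i j) xy) /pairing mulr_sumr.
  apply: eq_bigr => i _; rewrite mulr_sumr; apply: eq_bigr => j _.
  by rewrite -mulrA [G i j * _]mulrC.
have [uv'|vu|/val_inj uvE] := ltngtP u v; first exact: pG.
  rewrite -[in RHS]Gs mxE -pG //; apply: pairing_ext => i j _.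
  by rewrite !one_segmentE addrC.
by rewrite uvE eqxx in uv.
Qed.

Lemma cut_refl G a b : a = b %[mod N] -> cut G a b = 0.
Proof.
rewrite /cut => ->; rewrite /pairing big1 // => i _; rewrite big1 // => j _.
rewrite /separates.
by case: (leqP i _) => _; case: (leqP j _) => _; rewrite mul0r.
Qed.

Lemma cut_vertex G a : G^T = G -> (forall i, G i i = 0) ->
  cut G a a.+1 = vertex_weight (vertex_of a.+1) G.
Proof.
move=> Gs G0; rewrite vertex_weight_pairing //; apply: pairing_ext => i j ij.
rewrite -!(inj_eq val_inj) /= vertex_ofE modn_succ.
have := ltn_pmod a (ltn0Sn n.+2); move: (a %% N)%N => {}a aN.
have := ltn_ord j; rewrite /separates; move: (nat_of_ord i) (nat_of_ord j) ij => {}i {}j ij jN.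
case: eqP => [aE|_].
  by rewrite !leqn0; case: (leqP i a) => ?; case: (leqP j a) => ?; lia.
case: (leqP i a) => ?; case: (leqP j a) => ?; case: (leqP i a.+1) => ?;
  case: (leqP j a.+1) => ?; lia.
Qed.

(** The cut of a set of vertices has the parity of the sum of their degrees. *)
Lemma cut_even G a b : G^T = G -> (forall i, G i i = 0) ->
  (forall p, vertex_weight p G = 0) -> exists z, cut G a b = 2 * z.
Proof.
move=> Gs G0 R0; pose s (i : nat) := ((i <= a %% N) (+) (i <= b %% N))%N.
pose both := fun i j : 'I_N => (s i && s j)%:R : int.
exists (- pairing both G).
have sum0 : pairing (fun i j => (s i)%:R + (s j)%:R) G = 0.
  rewrite (pairing_full (fun i _ => (s i)%:R)) // big1 // => i _.
  by rewrite -mulr_sumr -/(vertex_weight i G) R0 mulr0.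
have zero0 : pairing (fun _ _ => 0) G = 0.
  by rewrite /pairing big1 // => i _; rewrite big1 // => j _; rewrite mul0r.
transitivity (pairing (fun i j => (s i)%:R + (s j)%:R) G + pairing (fun _ _ => 0) G
    - pairing both G - pairing both G); last by rewrite sum0 zero0; ring.
rewrite pairing_linear; apply: pairing_ext => i j _.
rewrite /both /separates /s; case: (leqP i _) => _; case: (leqP j _) => _;
  case: (leqP i _) => _; case: (leqP j _) => _ //.
Qed.

End Cuts.
Arguments vertex_of {n} u.

Section Compare.

Lemma weight_pos (m w1 w2 : int) : 0 <= w1 -> m = 2 * (w2 - w1) -> 0 < m -> 0 < w2.
Proof. lia. Qed.

Variable n : nat.
Local Notation N := n.+3.
Variables (G1 G2 : 'M[int]_N).
Hypotheses (wG1 : weighted_graph G1) (wG2 : weighted_graph G2).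
Hypothesis same_vertex : forall p, vertex_weight p G1 = vertex_weight p G2.
Hypothesis cut_le : forall k l : 'I_N, is_diagonal (k, l) ->
  cut_weight k l G1 <= cut_weight k l G2.

Let D a b := cut (G2 - G1) a b.

Let Gs : (G2 - G1)^T = G2 - G1.
Proof. by rewrite linearB /= !weighted_sym. Qed.

Let G0 i : (G2 - G1) i i = 0.
Proof. by rewrite !mxE !weighted_diag ?subrr. Qed.

Let R0 p : vertex_weight p (G2 - G1) = 0.
Proof.
rewrite /vertex_weight (eq_bigr (fun j => G2 p j - G1 p j)); last by move=> j _; rewrite !mxE.
by rewrite sumrB -!/(vertex_weight p _) same_vertex subrr.
Qed.

Let D_next a : D a a.+1 = 0.
Proof. by rewrite /D cut_vertex. Qed.

(** The pairs of gaps at the ends of a diagonal are covered by the hypothesis, and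
    those around a vertex by the equality of the degrees. *)
Lemma cut_diff_ge0 a b : 0 <= D a b.
Proof.
have Dlt c d : (c < d < N)%N -> 0 <= D c d.
  case/andP=> cd dN; have cN := ltn_trans cd dN.
  have [->|dc] := eqVneq d c.+1; first by rewrite D_next.
  have [/andP[/eqP c0 /eqP dn]|cdn] := boolP ((c == 0) && (d == n.+2))%N.
    have -> : D c d = D d d.+1; last by rewrite D_next.
    by rewrite /D cut_sym; apply: cut_mod; rewrite // c0 dn modnn mod0n.
  have cd_diag : is_diagonal (Ordinal cN, Ordinal dN).
    by rewrite /is_diagonal /is_edge /is_segment /= cd (negPf dc) cdn.
  have := cut_le cd_diag; rewrite !cut_weight_pairing ?weighted_sym //; try exact: weighted_diag.
  by rewrite /D /cut pairingD pairingN !modn_small // subr_ge0.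
have [aN bN] : (a %% N < N)%N /\ (b %% N < N)%N by rewrite !ltn_mod.
rewrite /D (@cut_mod _ _ a (a %% N) b (b %% N)) ?modn_mod //.
have [ab|ba|->] := ltngtP (a %% N)%N (b %% N)%N; first by apply: Dlt; rewrite ab.
  by rewrite cut_sym; apply: Dlt; rewrite ba.
by rewrite cut_refl.
Qed.

Let D_pos a b : 0 < D a b -> 2 <= D a b.
Proof. by have [z] := cut_even a b Gs G0 R0; rewrite /D => ->; lia. Qed.

Let D_mixed a b : a.+1 <> b.+1 %[mod N] -> D a b + D a.+1 b.+1 - D a.+1 b - D a b.+1 =
  2 * (G2 (vertex_of a.+1) (vertex_of b.+1) - G1 (vertex_of a.+1) (vertex_of b.+1)).
Proof.
move=> ab.
rewrite /D (cut_mixed Gs ab) [(G2 - G1) _ _]mxE [(- G1) _ _]mxE.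
by [].
Qed.

(** The mixed differences recover all the weights, edges included. *)
Lemma cuts_eq : (forall a b, D a b = 0) -> G1 = G2.
Proof.
move=> D0; apply/matrixP => i j; have [->|ij] := eqVneq i j.
  by rewrite !weighted_diag.
pose pred_of (u : 'I_N) := (u + n.+2)%N.
have vK u : vertex_of (pred_of u).+1 = u.
  apply/val_inj; rewrite /= vertex_ofE /pred_of -addnS modnDr modn_small //.
have := @D_mixed (pred_of i) (pred_of j); rewrite !D0 !vK => H.
have {}H : 0 + 0 - 0 - 0 = 2 * (G2 i j - G1 i j).
  apply: H => /eqP; rewrite -!addnS !modnDr !modn_small // => /eqP/val_inj e.
  by rewrite e eqxx in ij.
lia.
Qed.

Let D_sym a b : D a b = D b a. Proof. exact: cut_sym. Qed.

Let D_modn a a' b b' : a = a' %[mod N] -> b = b' %[mod N] -> D a b = D a' b'.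
Proof. exact: cut_mod. Qed.

Lemma modn_shift k a : (a + k * N = a %[mod N])%N.
Proof. by rewrite addnC modnMDl. Qed.

Lemma modn_succK a b : a.+1 = b.+1 %[mod N] -> a = b %[mod N].
Proof. by move/eqP; rewrite -(addn1 a) -(addn1 b) eqn_modDr => /eqP. Qed.

Lemma modn_succ_congr a b : a = b %[mod N] -> a.+1 = b.+1 %[mod N].
Proof. by rewrite -(addn1 a) -(addn1 b) => ab; rewrite -modnDml ab modnDml. Qed.

Let D_nonadjacent a b : 0 < D a b ->
  [/\ a <> b %[mod N], a <> b.+1 %[mod N] & b <> a.+1 %[mod N]].
Proof.
move=> Dab; split => ab; move: Dab.
- by rewrite /D cut_refl.
- by rewrite D_sym (D_modn (erefl (b %% N)%N) ab) D_next.
- by rewrite (D_modn (erefl _) ab) D_next.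
Qed.

Let G1_ge0 a b : a <> b %[mod N] -> a <> b.+1 %[mod N] -> b <> a.+1 %[mod N] ->
  0 <= G1 (vertex_of a) (vertex_of b).
Proof.
wlog ab : a b / (a %% N < b %% N)%N => [hwlog|].
  move=> neq; have [ab|ba|] := ltngtP (a %% N)%N (b %% N)%N; first exact: hwlog.
    by move=> ? ?; rewrite -(weighted_sym wG1) mxE; apply: hwlog => // /esym.
  by move/neq.
move=> neq ab1 ba1; have [_ _ Gd] := weightedP _ wG1; apply: Gd.
rewrite /is_diagonal /is_edge /is_segment /= !vertex_ofE ab /=.
have aN := ltn_pmod a (ltn0Sn n.+2); have bN := ltn_pmod b (ltn0Sn n.+2).
by move: ab1 ba1; rewrite !modn_succ; do 2!case: eqP; lia.
Qed.

(** A pair of gaps at which the cuts differ grows into a rectangle of such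
    pairs, two opposite corners of which are vertices joined in [G2]: the mixed
    difference is positive there, while the weight in [G1] is not negative. *)
Lemma positive_rectangle a0 b0 : 0 < D a0 b0 ->
  exists a b p q, [/\ forall x y, (x <= p)%N -> (y <= q)%N -> 0 < D (a + x) (b + y),
    0 < G2 (vertex_of a) (vertex_of b)
    & 0 < G2 (vertex_of (a + p).+1) (vertex_of (b + q).+1)].
Proof.
move=> D00; have D0 a b : a = b %[mod N] -> D a b = 0 by exact: cut_refl.
have [a [b [Dab mix1]]] : exists a b, 0 < D a b /\
    0 < D a b + D a.+1 b.+1 - D a.+1 b - D a b.+1.
  have [||||x [y [rect mix]]] := @corner (fun x y => D (a0 + x) (b0 + y))
      (b0 + a0 * n.+2) (a0 + b0 * n.+2).
  - by move=> x y; exact: cut_diff_ge0.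
  - by rewrite !addn0.
  - by apply: D0; rewrite addn0 addnCA -mulnS modn_shift.
  - by apply: D0; rewrite addn0 addnCA -mulnS modn_shift.
  exists (a0 + x)%N, (b0 + y)%N; split; first exact: rect.
  by move: mix; rewrite !addnS.
(* Adding multiples of N makes room for walking down from (a, b). *)
have shift c d : exists2 c', (d < c')%N & c' = c %[mod N].
  by exists (c + d.+1 * N)%N; [rewrite mulnS; lia|exact: modn_shift].
have [a' a'b a'E] := shift a b; have [b' b'a b'E] := shift b a.
have [||||x [y [rect mix]]] := @corner (fun x y => D (a' - x) (b' - y)) (a' - b) (b' - a).
- by move=> x y; exact: cut_diff_ge0.
- by rewrite !subn0 (D_modn a'E b'E).
- by apply: D0; rewrite subn0 subKn ?b'E // ltnW.
- by apply: D0; rewrite subn0 subKn ?a'E // ltnW.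
have xa : (x < a' - b)%N.
  rewrite ltnNge; apply/negP => ax; have := rect _ _ ax (leq0n _).
  by rewrite subn0 subKn ?(ltnW a'b) // D0 // b'E.
have yb : (y < b' - a)%N.
  rewrite ltnNge; apply/negP => bY; have := rect _ _ (leq0n _) bY.
  by rewrite subn0 subKn ?(ltnW b'a) // D0 // a'E.
exists (a' - x)%N, (b' - y)%N, x, y; split.
- move=> x' y' xx yy.
  by have := rect (x - x')%N (y - y')%N (leq_subr _ _) (leq_subr _ _); rewrite !subnA //; lia.
- have [ne1 ne2 ne3] := D_nonadjacent (rect x y (leqnn _) (leqnn _)).
  have G1ge := G1_ge0 ne1 ne2 ne3.
  have xE : (a' - x = (a' - x.+1).+1)%N
    by rewrite subnSK // (leq_trans xa) ?leq_subr.
  have yE : (b' - y = (b' - y.+1).+1)%N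
    by rewrite subnSK // (leq_trans yb) ?leq_subr.
  have := @D_mixed (a' - x.+1) (b' - y.+1); rewrite -xE -yE => /(_ ne1) mixE.
  apply: (weight_pos G1ge mixE); move: mix.
  by rewrite [X in X - _ - _]addrC [X in 0 < X -> _]addrAC.
have [ne1 ne2 ne3] := D_nonadjacent Dab.
have ne1' : a.+1 <> b.+1 %[mod N] by move/modn_succK.
have G1ge : 0 <= G1 (vertex_of a.+1) (vertex_of b.+1).
  by apply: G1_ge0 => // /modn_succK.
have mixE := D_mixed ne1'.
have vE u v : u = v %[mod N] -> vertex_of u = vertex_of v :> 'I_N
  by move=> e; rewrite /vertex_of; move: e => ->.
have xa' : (x <= a')%N := ltnW (leq_trans xa (leq_subr _ _)).
have yb' : (y <= b')%N := ltnW (leq_trans yb (leq_subr _ _)).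
rewrite !subnK //.
rewrite (vE _ _ (modn_succ_congr a'E)) (vE _ _ (modn_succ_congr b'E)).
exact: weight_pos G1ge mixE mix1.
Qed.

(** The rectangle of [positive_rectangle], read in the linear order of the
    vertices.  It stays off the pairs of equal or adjacent gaps, where [D]
    vanishes, so its sides are two disjoint arcs; their four ends are the ends of
    two crossing segments of [G2]. *)
Lemma positive_crossing a0 b0 : 0 < D a0 b0 -> exists i j k l : 'I_N,
  [/\ (i < j < k)%N, (k < l)%N, 0 < G2 i k, 0 < G2 j l &
    (forall c d, (c < N)%N -> (d < N)%N -> (i <= c < j)%N -> (k <= d < l)%N -> 0 < D c d) \/
    (forall c d, (c < N)%N -> (d < N)%N -> (j <= c < k)%N -> (l <= d)%N || (d < i)%N ->
       0 < D c d)].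
Proof.
have vE u v : u = v %[mod N] -> vertex_of u = vertex_of v :> 'I_N.
  by move=> e; rewrite /vertex_of; move: e => ->.
have G2C u v : 0 < G2 u v -> 0 < G2 v u.
  by rewrite -[in X in X -> _](weighted_sym wG2) mxE.
case/positive_rectangle=> a [b [p [q [rect Gab Gpq]]]].
wlog [aN ab baN] : a b rect Gab Gpq / [/\ (a < N)%N, (a < b)%N & (b < a + N)%N].
  have [neq _ _] := D_nonadjacent (rect p q (leqnn _) (leqnn _)) => hwlog.
  pose a1 := (a %% N)%N; pose b1 := (if a %% N < b %% N then b %% N else b %% N + N)%N.
  have a1E : a1 = a %[mod N] by rewrite modn_mod.
  have b1E : b1 = b %[mod N] by rewrite /b1; case: ifP => _; rewrite ?modnDr modn_mod.
  have add x y z : x = y %[mod N] -> (x + z = y + z %[mod N])%N.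
    by move=> e; rewrite -modnDml e modnDml.
  apply: (hwlog a1 b1).
  - by move=> x y xp yq; rewrite (D_modn (add _ _ _ a1E) (add _ _ _ b1E)) rect.
  - by rewrite (vE _ _ a1E) (vE _ _ b1E).
  - have e1 := modn_succ_congr (add _ _ p a1E); have e2 := modn_succ_congr (add _ _ q b1E).
    by rewrite (vE _ _ e1) (vE _ _ e2).
  have neq' : a <> b %[mod N].
    have := rect 0%N 0%N (leq0n _) (leq0n _).
    by rewrite !addn0 => /D_nonadjacent[].
  have aN := ltn_pmod a (ltn0Sn n.+2); have bN := ltn_pmod b (ltn0Sn n.+2).
  rewrite /b1 /a1; move: (a %% N)%N (b %% N)%N aN bN neq'; clear.
  by move=> a b aN bN neq; split => //; case: (ltnP a b); lia.
have pb : ((a + p).+1 < b)%N.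
  rewrite ltnNge; apply/negP => bp.
  have xp : (b.-1 - a <= p)%N by move: bp ab; clear; lia.
  have := rect _ 0%N xp (leq0n _); rewrite addn0 (_ : a + (b.-1 - a) = b.-1)%N.
    by have -> : b = b.-1.+1; [rewrite prednK // (leq_ltn_trans _ ab)|rewrite D_next].
  by move: ab; clear; lia.
have qa : ((b + q).+1 < a + N)%N.
  rewrite ltnNge; apply/negP => aq.
  have yq : ((a + N).-1 - b <= q)%N by move: aq baN; clear; lia.
  have := rect 0%N _ (leq0n _) yq; rewrite addn0 (_ : b + ((a + N).-1 - b) = (a + N).-1)%N.
    rewrite D_sym (@D_modn _ (a + N).-1 a (a + N).-1.+1) //.
      by rewrite D_next.
    by rewrite prednK ?modnDr // addn_gt0 orbT.
  by move: baN; clear; lia.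
have in_rect c d : (a <= c <= a + p)%N -> (b <= d <= b + q)%N -> 0 < D c d.
  move=> /andP[ac cp] /andP[bd dq].
  by rewrite -(subnKC ac) -(subnKC bd) rect // leq_subLR.
have in_rect' c d : (a <= c <= a + p)%N || (a <= c + N <= a + p)%N ->
    (b <= d <= b + q)%N || (b <= d + N <= b + q)%N -> 0 < D c d.
  have sh x : (x + N = x %[mod N])%N by exact: modnDr.
  case/orP=> hc /orP[] hd; have := in_rect _ _ hc hd => //.
  - by rewrite (D_modn (erefl (c %% N)%N) (sh d)).
  - by rewrite (D_modn (sh c) (erefl (d %% N)%N)).
  - by rewrite (D_modn (sh c) (sh d)).
have vo u : (u < N)%N -> (vertex_of u : 'I_N) = u :> nat.
  by move=> uN; rewrite vertex_ofE modn_small.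
have vo' u : (N <= u)%N -> (u < N + N)%N -> (vertex_of u : 'I_N) = (u - N)%N :> nat.
  move=> Nu uN; rewrite vertex_ofE -[in LHS](subnK Nu) modnDr modn_small //.
  by move: uN Nu; clear; lia.
(* The corners a < u2 < b < v2 < a + N are in cyclic order; the four cases are
   the possible numbers of them that reach N. *)
set u2 := (a + p).+1 in Gpq pb; set v2 := (b + q).+1 in Gpq qa.
have [v2N|Nv2] := ltnP v2 N.
  exists (vertex_of a), (vertex_of u2), (vertex_of b), (vertex_of v2).
  have -> := vo v2 v2N; have [bN u2N] : (b < N /\ u2 < N)%N.
    by move: v2N pb; rewrite /u2 /v2; clear; lia.
  rewrite !vo //; split => //.
  - by rewrite /u2 ltnS leq_addr.
  - by rewrite /v2 ltnS leq_addr.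
  by left=> c d _ _ hc hd; apply: in_rect.
have v2E := vo' v2 Nv2; have [bN|Nb] := ltnP b N.
  exists (vertex_of v2), (vertex_of a), (vertex_of u2), (vertex_of b).
  have u2N : (u2 < N)%N := ltn_trans pb bN.
  rewrite v2E ?vo //; last by move: qa aN; clear; lia.
  split => //; try by [exact: G2C | move: qa pb Nv2; rewrite /u2; clear; lia].
  right=> c d cN dN hc hd; apply: in_rect'; first by rewrite hc.
  by move: hd dN bN Nv2; rewrite /v2; clear; lia.
have [u2N|Nu2] := ltnP u2 N.
  exists (vertex_of b), (vertex_of v2), (vertex_of a), (vertex_of u2).
  rewrite v2E ?(vo' b) ?vo //; try by move: qa baN aN; clear; lia.
  split => //; try by [exact: G2C | move: qa pb Nb Nv2; rewrite /u2 /v2; clear; lia].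
  left=> c d cN dN hc hd; rewrite D_sym; apply: in_rect'; first by rewrite hd.
  by move: hc Nb; rewrite /v2; clear; lia.
exists (vertex_of u2), (vertex_of b), (vertex_of v2), (vertex_of a).
rewrite v2E ?(vo' b) ?(vo' u2) ?vo //; try by move: qa baN pb aN; clear; lia.
split => //; try by [exact: G2C | move: qa pb Nb Nv2 Nu2; rewrite /u2 /v2; clear; lia].
right=> c d cN dN hc hd; rewrite D_sym; apply: in_rect'.
  by move: hd dN aN Nu2; rewrite /u2; clear; lia.
by move: hc Nb; rewrite /v2; clear; lia.
Qed.

(** The resolution that loses the cuts in the rectangle stays above [G1], because
    the differences are even. *)
Lemma resolvable : G1 <> G2 -> exists i j k l : 'I_N,
  [/\ (i < j < k)%N, (k < l)%N, 0 < G2 i k, 0 < G2 j l &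
    exists2 R, R = resolve_outer G2 i j k l \/ R = resolve_inner G2 i j k l &
      (forall p, vertex_weight p G1 = vertex_weight p R) /\
      (forall c d : 'I_N, is_diagonal (c, d) -> cut_weight c d G1 <= cut_weight c d R)].
Proof.
move=> G12; have [/existsP[a /existsP[b Dab]]|noD] :=
    boolP [exists a : 'I_N, exists b : 'I_N, 0 < D a b]; last first.
  case: G12; apply: cuts_eq => a b; apply/eqP; rewrite eq_le cut_diff_ge0 andbT leNgt.
  rewrite -(D_modn (modn_mod a N) (modn_mod b N)).
  move/existsPn: noD => /(_ (vertex_of a))/existsPn/(_ (vertex_of b)).
  by rewrite !vertex_ofE.
have [i [j [k [l [ijk kl Gik Gjl rect]]]]] := positive_crossing Dab.
exists i, j, k, l; split => //.
have DE (c d : 'I_N) : D c d = pairing (fun i j => (separates c d i j)%:R) G2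
                             - pairing (fun i j => (separates c d i j)%:R) G1.
  by rewrite /D /cut pairingD pairingN !modn_small.
have cut_pairing G (c d : 'I_N) : weighted_graph G -> (c < d)%N ->
    cut_weight c d G = pairing (fun i j => (separates c d i j)%:R) G.
  by move=> wG cd; rewrite cut_weight_pairing ?weighted_sym //; exact: weighted_diag.
have vertex_pairing G p : weighted_graph G ->
    vertex_weight p G = pairing (fun i j => (i == p)%:R + (j == p)%:R) G.
  by move=> wG; rewrite vertex_weight_pairing ?weighted_sym //; exact: weighted_diag.
case: rect => rect.
  have wR := weighted_outer wG2 ijk kl Gik Gjl.
  exists (resolve_outer G2 i j k l); first by left.
  split=> [p|c d /andP[cd _]].
    rewrite same_vertex !vertex_pairing // pairing_outer //; ring.
  rewrite !cut_pairing // pairing_outer //.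
  have cN := ltn_ord c; have dN := ltn_ord d.
  have := separates_outer c d ijk kl; have := cut_diff_ge0 c d; have := D_pos (a := c) (b := d).
  case: orP => [rcd|_]; last by rewrite DE; move: (pairing _ G1) (pairing _ G2); clear; lia.
  have Dcd : 0 < D c d.
    by case: rcd => /andP[h1 h2]; [|rewrite D_sym]; exact: rect.
  by move/(_ Dcd); rewrite DE; move: (pairing _ G1) (pairing _ G2); clear; lia.
have wR := weighted_inner wG2 ijk kl Gik Gjl.
exists (resolve_inner G2 i j k l); first by right.
split=> [p|c d /andP[cd _]].
  rewrite same_vertex !vertex_pairing // pairing_inner //; ring.
rewrite !cut_pairing // pairing_inner //.
have cN := ltn_ord c; have dN := ltn_ord d.
have := separates_inner c d ijk kl; have := cut_diff_ge0 c d; have := D_pos (a := c) (b := d).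
case: orP => [rcd|_]; last by rewrite DE; move: (pairing _ G1) (pairing _ G2); clear; lia.
have Dcd : 0 < D c d.
  by case: rcd => /andP[h1 h2]; [|rewrite D_sym]; exact: rect.
by move/(_ Dcd); rewrite DE; move: (pairing _ G1) (pairing _ G2); clear; lia.
Qed.

End Compare.

(** * The order on monomials *)

Section OrderTheorem.
Variables (n : nat) (X : positive_space n).
Implicit Types (G : 'M[int]_n.+3) (T : {set segment n}).
Local Notation N := n.+3.
Local Notation I := (graph_monomial X).

Lemma LplusD (f g : X) : Lplus f -> Lplus g -> Lplus (f + g).
Proof.
move=> Lf Lg T triT; have [p [m [p0 ->]]] := Lf T triT; have [q [m' [q0 ->]]] := Lg T triT.
exists (p * 'X_[m'] + q * 'X_[m]), (m + m')%MM; split.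
  move=> e; rewrite mcoeffD.
  by apply: addr_ge0; apply: mcoeff_nonneg_mul => // ?; exact: mcoeffXm_ge0.
have m0 (k : 'X_{1..#|with_edges T|}) := config_monomial_neq0 triT k (A_config X).
by rewrite addf_div // mmap1D /poly_in rmorphD !rmorphM /= -!/(poly_in _ _) !poly_inXm.
Qed.

Lemma Lplus0 : Lplus (0 : X).
Proof.
move=> T triT; exists 0, 0%MM; split; first by move=> e; rewrite mcoeff0.
by rewrite /poly_in rmorph0 mul0r.
Qed.

Lemma graph_monomialE G : I G = config_monomial G (A X).
Proof. by []. Qed.

Definition below G1 G2 : Prop :=
  (forall p : 'I_N, vertex_weight p G1 = vertex_weight p G2) /\
  (forall k l : 'I_N, is_diagonal (k, l) -> cut_weight k l G1 <= cut_weight k l G2).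

Lemma chart_below T G1 G2 : complete_triangulation T ->
  weighted_graph G1 -> weighted_graph G2 ->
  positive_laurent (A X) (with_edges T) (I G2 - I G1) -> below G1 G2.
Proof.
move=> triT w1 w2 H; split=> [p|k l /andP[kl _]].
  exact: positive_laurent_vertex triT w1 w2 H.
exact: positive_laurent_cut triT w1 w2 H kl.
Qed.

(** Induction on [size_graph G2]: resolving a crossing of [G2] splits its monomial
    in two, one of which is still above that of [G1]. *)
Lemma below_Lle G1 G2 : weighted_graph G1 -> weighted_graph G2 ->
  below G1 G2 -> Lle (I G1) (I G2).
Proof.
move=> w1; have [s] := ubnP (size_graph G2); elim: s G2 => // s IHs G2 sG w2 [R12 C12].
have [->|/eqP ne] := eqVneq G1 G2; first by rewrite /Lle subrr; exact: Lplus0.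
have [i [j [k [l [ijk kl Gik Gjl [R RE RB]]]]]] := resolvable w1 w2 R12 C12 ne.
have [so si] := size_resolve w2 ijk kl Gik Gjl.
have wo := weighted_outer w2 ijk kl Gik Gjl.
have wi := weighted_inner w2 ijk kl Gik Gjl.
have GE := config_monomial_resolve G2 ijk kl (A_config X).
have step R' : (size_graph R' < size_graph G2)%N -> weighted_graph R' -> below G1 R' ->
    Lle (I G1) (I R').
  by move=> sR wR B; apply: IHs => //; apply: leq_trans sR _.
rewrite /Lle [I G2]GE -!graph_monomialE.
case: RE RB => -> RB.
  by rewrite -addrA; apply: LplusD; [exact: Lplus_monomial|exact: step].
by rewrite addrAC; apply: LplusD; [exact: step|exact: Lplus_monomial].
Qed.

Lemma exists_triangulation : exists T : {set segment n}, complete_triangulation T.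
Proof. by have [T triT _] := complete_triangulation_sub (noncrossing_set0 n); exists T. Qed.

Lemma LleP G1 G2 : weighted_graph G1 -> weighted_graph G2 ->
  (Lle (I G1) (I G2) <-> below G1 G2).
Proof.
move=> w1 w2; split; last exact: below_Lle.
by have [T triT] := exists_triangulation; move=> /(_ T triT); exact: chart_below.
Qed.

Lemma below_anti G1 G2 : weighted_graph G1 -> weighted_graph G2 ->
  below G1 G2 -> below G2 G1 -> G1 = G2.
Proof.
move=> w1 w2 [R12 C12] [R21 C21]; apply: (cuts_eq w1 w2) => a b.
apply: le_anti; rewrite cut_diff_ge0 // andbT.
by rewrite -oppr_ge0 /cut -pairingN opprB; exact: cut_diff_ge0.
Qed.

(** Equal monomials are below each other. *)
Lemma graph_monomial_inj : {in @weighted_graph n &, injective I}.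
Proof.
move=> G1 G2 w1 w2 I12; apply: below_anti => //; apply/LleP => //; rewrite /Lle I12 subrr;
  exact: Lplus0.
Qed.

End OrderTheorem.

(** * Noncrossing graphs and their charts *)

Section Charts.
Variables (n : nat) (X : positive_space n).
Implicit Types (G : 'M[int]_n.+3) (T : {set segment n}).
Local Notation N := n.+3.
Local Notation I := (graph_monomial X).

Definition positive_support G : {set segment n} :=
  [set s | is_diagonal s && (0 < G s.1 s.2)].

Definition noncrossing_graph G : bool :=
  weighted_graph G && noncrossing_diagonals (positive_support G).

Lemma noncrossing_weighted G : noncrossing_graph G -> weighted_graph G.
Proof. by case/andP. Qed.

Lemma noncrossing_graphP G : weighted_graph G ->
  reflect (forall i j k l : 'I_N, (i < j < k)%N -> (k < l)%N -> 0 < G i k -> 0 < G j l -> False)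
          (noncrossing_graph G).
Proof.
move=> wG; rewrite /noncrossing_graph wG /=; apply: (iffP andP).
  case=> _ /forallP nc i j k l ijk kl Gik Gjl; case/andP: ijk => ij jk.
  have dik : (i, k) \in positive_support G.
    rewrite inE /= Gik andbT /is_diagonal /is_edge /is_segment /= (ltn_trans ij jk) /=.
    by have := ltn_ord l; lia.
  have djl : (j, l) \in positive_support G.
    rewrite inE /= Gjl andbT /is_diagonal /is_edge /is_segment /= (ltn_trans jk kl) /=.
    by have := ltn_ord l; lia.
  have /implyP/(_ dik)/forallP/(_ (j, l))/implyP/(_ djl) := nc (i, k).
  by rewrite /crossing /= ij jk kl.
move=> nc; split.
  by apply/forallP => s; apply/implyP; rewrite inE => /andP[].
apply/forallP => -[i k]; apply/implyP; rewrite inE /= => /andP[_ Gik].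
apply/forallP => -[j l]; apply/implyP; rewrite inE /= => /andP[_ Gjl].
apply/negP; rewrite /crossing /= => /orP[/and3P[ij jk kl]|/and3P[ij jk kl]].
  by apply: (nc i j k l) => //; rewrite ij jk.
by apply: (nc j i l k) => //; rewrite ij jk.
Qed.

(** A graph that is not minimal has a crossing to resolve. *)
Lemma below_noncrossing G1 G2 : weighted_graph G1 -> noncrossing_graph G2 ->
  below G1 G2 -> G1 = G2.
Proof.
move=> w1 nc2 [R12 C12]; have w2 := noncrossing_weighted nc2.
have [//|/eqP ne] := eqVneq G1 G2.
have [i [j [k [l [ijk kl Gik Gjl _]]]]] := resolvable w1 w2 R12 C12 ne.
by have /(noncrossing_graphP w2)/(_ _ _ _ _ ijk kl Gik Gjl) := nc2.
Qed.

Definition chart_of G : {set segment n} :=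
  odflt set0 [pick T | complete_triangulation T && (positive_support G \subset T)].

Lemma chart_ofP G : noncrossing_graph G ->
  complete_triangulation (chart_of G) /\ positive_support G \subset chart_of G.
Proof.
case/andP=> _ /complete_triangulation_sub[T triT ST].
rewrite /chart_of; case: pickP => [T' /andP[] //|/(_ T)].
by rewrite triT ST.
Qed.

(** ** Coordinates of a graph in a chart *)

Section OneChart.
Variable T : {set segment n}.
Hypothesis triT : complete_triangulation T.
Local Notation S := (with_edges T).
Local Notation monomials := 'X_{1..#|S|}.

Definition in_chart G : bool := positive_support G \subset T.

(** The graph of a Laurent monomial of the chart; an exponent on a diagonal may be
    negative. *)
Definition graph_of (z : 'I_#|S| -> int) : 'M[int]_N :=
  \matrix_(i, j) \sum_(k < #|S|)
    z k * one_segment (enum_val k).1 (enum_val k).2 i j.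

Lemma eq_graph_of z z' : z =1 z' -> graph_of z = graph_of z'.
Proof.
by move=> zz; apply/matrixP => i j; rewrite !mxE; apply: eq_bigr => k _; rewrite zz.
Qed.

Lemma graph_of_sym z : (graph_of z)^T = graph_of z.
Proof.
apply/matrixP => i j; rewrite !mxE; apply: eq_bigr => k _; congr (_ * _).
by rewrite -{1}one_segment_sym mxE.
Qed.

Lemma one_segment_diag (i j x : 'I_N) : (i < j)%N -> one_segment i j x x = 0.
Proof.
move=> ij; rewrite one_segmentE andbC; case: (x =P j) => [->|_] //=.
by rewrite -val_eqE /= gtn_eqF.
Qed.

Lemma segment_lt (k : 'I_#|S|) : ((enum_val k).1 < (enum_val k).2)%N.
Proof. by have := with_edges_segment triT (enum_valP k). Qed.

Lemma graph_of_diag z i : graph_of z i i = 0.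
Proof. by rewrite mxE big1 // => k _; rewrite one_segment_diag ?segment_lt ?mulr0. Qed.

Lemma one_segment_val (k k' : 'I_#|S|) :
  one_segment (enum_val k').1 (enum_val k').2 (enum_val k).1 (enum_val k).2 = (k' == k)%:R.
Proof.
rewrite one_segmentE.
have -> : ((enum_val k).1 == (enum_val k').1) && ((enum_val k).2 == (enum_val k').2) = (k' == k).
  by rewrite -xpair_eqE -!surjective_pairing (inj_eq enum_val_inj) eq_sym.
rewrite (_ : (_ == (enum_val k').2) && _ = false) ?addr0 //.
apply/negP => /andP[/eqP e /eqP e']; have := segment_lt k; have := segment_lt k'.
by rewrite e e'; lia.
Qed.

Lemma graph_of_val z (k : 'I_#|S|) : graph_of z (enum_val k).1 (enum_val k).2 = z k.
Proof.
rewrite mxE (bigD1 k) //= [X in _ + X]big1 => [|k' /negPf k'k].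
  by rewrite one_segment_val eqxx mulr1 addr0.
by rewrite one_segment_val k'k mulr0.
Qed.

Lemma graph_of_out z (i j : 'I_N) : (i < j)%N -> (i, j) \notin S -> graph_of z i j = 0.
Proof.
move=> ij ijS; rewrite mxE big1 // => k _; rewrite one_segmentE.
have -> : (i == (enum_val k).1) && (j == (enum_val k).2) = false.
  apply/negP; rewrite -xpair_eqE -surjective_pairing => /eqP e.
  by move: ijS; rewrite e enum_valP.
have -> : (i == (enum_val k).2) && (j == (enum_val k).1) = false.
  by apply/negP => /andP[/eqP ei /eqP ej]; have := segment_lt k; rewrite -ei -ej; lia.
by rewrite mulr0.
Qed.

Lemma in_chart_out G (i j : 'I_N) : weighted_graph G -> in_chart G ->
  (i < j)%N -> (i, j) \notin S -> G i j = 0.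
Proof.
move=> /weightedP[_ _ Gd] /subsetP GT ij; rewrite !inE negb_or => /andP[ijT nij].
have d : is_diagonal (i, j) by rewrite /is_diagonal /is_segment /= ij.
apply/eqP; rewrite eq_le Gd // andbT leNgt; apply: contra ijT => Gij.
by apply: GT; rewrite inE d.
Qed.

Lemma graph_ofK G : weighted_graph G -> in_chart G ->
  graph_of (fun k => G (enum_val k).1 (enum_val k).2) = G.
Proof.
move=> wG GT; have [Gs G0 _] := weightedP _ wG.
set H := graph_of _.
have lt (i j : 'I_N) : (i < j)%N -> H i j = G i j.
  move=> ij; have [ijS|ijS] := boolP ((i, j) \in S); last first.
    by rewrite /H graph_of_out // in_chart_out.
  by rewrite -[i]/((i, j).1) -[j]/((i, j).2) -(enum_rankK_in ijS ijS) graph_of_val.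
apply/matrixP => i j; have [ij|ji|/val_inj->] := ltngtP i j; first exact: lt.
  have Hs : H^T = H := graph_of_sym _.
  by rewrite -Hs -[in RHS]Gs [H^T i j]mxE [G^T i j]mxE lt.
by rewrite G0 graph_of_diag.
Qed.

Lemma pairing_graph_of f z :
  pairing f (graph_of z) = \sum_(k < #|S|) z k * f (enum_val k).1 (enum_val k).2.
Proof.
under [RHS]eq_bigr => k _ do rewrite -(pairing_one_segment f (segment_lt k)) /pairing mulr_sumr.
rewrite exchange_big; apply: eq_bigr => i _ /=.
under [RHS]eq_bigr => k _ do rewrite mulr_sumr.
rewrite exchange_big; apply: eq_bigr => j _ /=; rewrite mxE mulr_sumr.
by apply: eq_bigr => k _; rewrite mulrCA.
Qed.

Definition pos_exp G : monomials :=
  [multinom absz (Num.max 0 (G (enum_val k).1 (enum_val k).2)%R)%R | k < #|S|].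
Definition neg_exp G : monomials :=
  [multinom absz (Num.max 0 (- G (enum_val k).1 (enum_val k).2)%R)%R | k < #|S|].

Lemma pos_neg_exp G k : (pos_exp G k)%:Z - (neg_exp G k)%:Z = G (enum_val k).1 (enum_val k).2.
Proof. by rewrite !mnmE; move: (G _ _) => w; clear; lia. Qed.

Lemma config_monomial_in_chart (K : fieldType) (a : 'I_N -> 'I_N -> K) G :
  plucker_config a -> weighted_graph G -> in_chart G ->
  config_monomial G a = mmap1 (coordinates a (S := S)) (pos_exp G) /
                        mmap1 (coordinates a (S := S)) (neg_exp G).
Proof.
move=> ca wG GT; have [a0 _] := ca.
transitivity (\prod_(s in S) a s.1 s.2 ^ G s.1 s.2).
  rewrite /config_monomial pair_big_dep /=.
  rewrite (bigID (fun s : segment n => s \in S)) /= [X in _ * X]big1 ?mulr1.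
    apply: eq_bigl => s; case: (boolP (s \in S)) => [/(with_edges_segment triT)|]; last by rewrite andbF.
    by rewrite /is_segment => ->.
  by move=> [i j] /andP[/= ij ijS]; rewrite in_chart_out.
rewrite big_enum_val /= -prodf_div; apply: eq_bigr => k _.
rewrite -pos_neg_exp expfzDr ?a0 ?segment_lt //.
by rewrite -invr_expz.
Qed.

(** In some Laurent expansion of [f] the monomial of [G] has the coefficient [c].
    Multiplying by the negative part of the exponents of [G] turns it into the
    coefficient of a polynomial. *)
Definition has_coef G (f : X) (c : int) : Prop :=
  exists (p : {mpoly int[#|S|]}) (m : monomials),
    f = poly_in (A X) p / mmap1 (coordinates (A X) (S := S)) m /\
    (p * 'X_[neg_exp G])@_(m + pos_exp G) = c.

Let monomial_neq0 (m : monomials) := config_monomial_neq0 triT m (A_config X).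

Lemma has_coefD G f g c d : has_coef G f c -> has_coef G g d -> has_coef G (f + g) (c + d).
Proof.
move=> [p [m [-> pc]]] [q [m' [-> qd]]].
exists (p * 'X_[m'] + q * 'X_[m]), (m + m')%MM; split.
  rewrite addf_div ?monomial_neq0 // mmap1D.
  by rewrite /poly_in rmorphD !rmorphM /= -!/(poly_in _ _) !poly_inXm.
rewrite mulrDl mcoeffD; congr (_ + _).
  by rewrite mulrAC [(m + m')%MM]addmC -addmA mcoeffMX.
by rewrite mulrAC -addmA mcoeffMX.
Qed.

Lemma has_coefZ G f c z : has_coef G f c -> has_coef G (z%:~R * f) (z * c).
Proof.
move=> [p [m [-> pc]]]; exists (z%:MP * p), m; split.
  by rewrite /poly_in rmorphM /= mmapC mulrA.
by rewrite -mulrA mcoeffCM pc.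
Qed.

Lemma has_coef_self G : weighted_graph G -> in_chart G -> has_coef G (I G) 1.
Proof.
move=> wG GT; exists 'X_[pos_exp G], (neg_exp G); split.
  by rewrite poly_inXm [I G]config_monomial_in_chart //; exact: A_config.
by rewrite -mpolyXD mcoeffX addmC eqxx.
Qed.

(** If the monomial of [G] occurs in the positive expansion of that of [H], then
    it can be subtracted in this chart, so that [G] is below [H]. *)
Lemma has_coef_other G H : weighted_graph G -> in_chart G -> noncrossing_graph H ->
  G != H -> has_coef G (I H) 0.
Proof.
move=> wG GT ncH; have wH := noncrossing_weighted ncH.
have [p [m [p0 HE]]] := Lplus_monomial X wH triT.
have [c0|c0 /eqP[]] := eqVneq ((p * 'X_[neg_exp G])@_(m + pos_exp G)) 0.
  by move=> _; exists p, m.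
apply: below_noncrossing => //; apply: (chart_below (X := X) triT) => //.
exists (p * 'X_[neg_exp G] - 'X_[m + pos_exp G]), (m + neg_exp G)%MM; split; last first.
  rewrite HE [I G]config_monomial_in_chart //; last exact: A_config.
  rewrite -mulNr addf_div ?monomial_neq0 // mmap1D /poly_in rmorphB rmorphM /= -!/(poly_in _ _) !poly_inXm.
  by rewrite mmap1D mulNr [X in _ - X]mulrC.
have pX e : 0 <= (p * 'X_[neg_exp G])@_e.
  by apply: mcoeff_nonneg_mul => // ?; exact: mcoeffXm_ge0.
move=> e; rewrite mcoeffB mcoeffX; case: eqP => [<-|_]; last by rewrite subr0.
by rewrite subr_ge0 -gtz0_ge1 lt_neqAle eq_sym c0 pX.
Qed.

(** Each term of the numerator is the monomial of a single graph. *)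
Lemma finite_coefs f : Lplus f -> exists (Gs : seq 'M[int]_N) (c : 'M[int]_N -> int),
  forall G, weighted_graph G -> in_chart G ->
    [/\ has_coef G f (c G), 0 <= c G & c G != 0 -> G \in Gs].
Proof.
move=> /(_ T triT) [p [m [p0 fE]]].
exists [seq graph_of (fun k => ((e : monomials) k)%:Z - (m k)%:Z) | e <- msupp p].
exists (fun G => (p * 'X_[neg_exp G])@_(m + pos_exp G)) => G wG GT; split.
- by exists p, m.
- by apply: mcoeff_nonneg_mul => // e; exact: mcoeffXm_ge0.
rewrite -mcoeff_msupp => /msuppM_le/allpairsP[[e e'] /= [ep]].
rewrite msuppX inE => /eqP -> mE; apply/mapP; exists e => //.
rewrite -[LHS](graph_ofK wG GT); apply: eq_graph_of => k.
have := congr1 (fun q : monomials => q k) mE; rewrite !mnmDE -pos_neg_exp.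
by move: (pos_exp G k) (neg_exp G k) (e k) (m k); clear; lia.
Qed.

End OneChart.
End Charts.

(** * Leading monomials *)

Section Leading.
Variable n : nat.
Local Notation N := n.+3.
Local Notation R := {mpoly int[N + N]}.
Implicit Types (G : 'M[int]_N) (T : {set segment n}).

Definition lead (i j : 'I_N) : 'X_{1..N + N} := (U_(lshift N i) + U_(rshift N j))%MM.

(** This is [x_i * y_j - y_i * x_j], where [lshift] numbers the [x_i] and [rshift]
    the [y_j]. *)
Definition generic_minor (i j : 'I_N) : R := 'X_[lead i j] - 'X_[lead j i].

Lemma lead_x i j p : lead i j (lshift N p) = (i == p).
Proof. by rewrite /lead mnmDE !mnm1E (inj_eq (@lshift_inj _ _)) eq_rlshift addn0. Qed.

Lemma lead_y i j p : lead i j (rshift N p) = (j == p).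
Proof. by rewrite /lead mnmDE !mnm1E (inj_eq (@rshift_inj _ _)) eq_lrshift. Qed.

(** The order is lexicographic in a given degree, and the variables [x] come before
    the [y], in the order of the vertices. *)
Lemma lead_lt (i j : 'I_N) : (i < j)%N -> (lead j i < lead i j)%O.
Proof.
move=> ij; have ne (k : 'I_N) : (k <= i)%N -> (j == k) = false.
  by move=> ki; rewrite -val_eqE /= gtn_eqF // (leq_ltn_trans ki).
apply/ltmcP; first by rewrite /lead !mdegD !mdeg1.
exists (lshift N i) => [k|]; last by rewrite !lead_x eqxx ne.
case: (split_ordP k) => k' -> /= ki; last by have := ltn_ord i; lia.
by rewrite !lead_x -!val_eqE /= (gtn_eqF ki) (gtn_eqF (ltn_trans ki ij)).
Qed.

Lemma mlead_minor (i j : 'I_N) : (i < j)%N -> mlead (generic_minor i j) = lead i j.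
Proof.
by move=> ij; rewrite /generic_minor mleadDl ?mleadN !mleadXm ?lead_lt.
Qed.

Lemma minor_neq0 (i j : 'I_N) : (i < j)%N -> generic_minor i j != 0.
Proof.
move=> ij; rewrite -mleadc_eq0 mlead_minor // mcoeffB !mcoeffX eqxx.
by rewrite (lt_eqF (lead_lt ij)) subr0 oner_eq0.
Qed.

Definition generic_config (i j : 'I_N) : {fraction R} := FracField.tofrac (generic_minor i j).

Lemma generic_plucker : plucker_config generic_config.
Proof.
split=> [i j ij|i j k l _ _]; first by rewrite /generic_config tofrac_eq0 minor_neq0.
rewrite /generic_config -!tofracM -tofracD; congr FracField.tofrac.
by rewrite /generic_minor /lead !mpolyXD; ring.
Qed.

Section OneChart.
Variable T : {set segment n}.
Hypothesis triT : complete_triangulation T.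
Local Notation S := (with_edges T).
Local Notation monomials := 'X_{1..#|S|}.

Definition chart_minor (k : 'I_#|S|) : R := generic_minor (enum_val k).1 (enum_val k).2.

Let segk (k : 'I_#|S|) : ((enum_val k).1 < (enum_val k).2)%N := segment_lt triT k.

Lemma poly_in_generic (p : {mpoly int[#|S|]}) :
  poly_in generic_config p = FracField.tofrac (mmap intr chart_minor p).
Proof. by rewrite (rmorph_mmap (@FracField.tofrac R)). Qed.

Definition leads (e : monomials) : 'X_{1..N + N} :=
  (\sum_(k < #|S|) lead (enum_val k).1 (enum_val k).2 *+ e k)%MM.

Lemma leads_x e p : leads e (lshift N p) = (\sum_(k < #|S|) ((enum_val k).1 == p) * e k)%N.
Proof. by rewrite /leads mnm_sumE; apply: eq_bigr => k _; rewrite mulmnE lead_x. Qed.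

Lemma leads_y e p : leads e (rshift N p) = (\sum_(k < #|S|) ((enum_val k).2 == p) * e k)%N.
Proof. by rewrite /leads mnm_sumE; apply: eq_bigr => k _; rewrite mulmnE lead_y. Qed.

Lemma leadsD e e' : leads (e + e') = (leads e + leads e')%MM.
Proof.
rewrite /leads -big_split; apply: eq_bigr => k _ /=.
by apply/mnmP => i; rewrite !(mnmDE, mulmnE) mulnDr.
Qed.

(** If the two exponents differ, take a shortest segment [(i, j)] at which they
    do; balancing the starts at [i] and the ends at [j] takes two longer
    segments, one from [i] and one to [j], which cross. *)
Lemma leads_inj : injective leads.
Proof.
move=> e e' ee; apply/mnmP => k0; apply/eqP; apply/negPn/negP => ek0.
pose P k := e k != e' k.
have [k Pk kmin] : exists2 k, P k & forall k', P k' ->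
    ((enum_val k).2 - (enum_val k).1 <= (enum_val k').2 - (enum_val k').1)%N.
  by case: (@arg_minnP _ k0 P (fun k => (enum_val k).2 - (enum_val k).1)%N ek0) => k; exists k.
have other (f : segment n -> 'I_N) :
    (forall p, \sum_(k < #|S|) (f (enum_val k) == p) * e k =
               \sum_(k < #|S|) (f (enum_val k) == p) * e' k)%N ->
    exists k', [/\ k' != k, P k' & f (enum_val k') = f (enum_val k)].
  move=> /(_ (f (enum_val k))); rewrite (bigD1 k) //= [RHS](bigD1 k) //= eqxx !mul1n => sumE.
  have [/existsP[k' /and3P[? ? /eqP ?]]|no] :=
      boolP [exists k', [&& k' != k, P k' & f (enum_val k') == f (enum_val k)]].
    by exists k'.
  case/negP: Pk; rewrite -(eqn_add2r (\sum_(i < #|S| | i != k)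
    (f (enum_val i) == f (enum_val k)) * e i)) sumE; apply/eqP; congr (_ + _)%N.
  apply: eq_bigr => k' k'k; move/existsPn: no => /(_ k'); rewrite k'k /= negb_and negbK.
  by case/orP=> [/eqP->|/negPf->].
have [|k1 [k1k Pk1 k1E]] := other fst; first by move=> p; rewrite -!leads_x ee.
have [|k2 [k2k Pk2 k2E]] := other snd; first by move=> p; rewrite -!leads_y ee.
have nc := with_edges_not_crossing triT (enum_valP k2) (enum_valP k1).
have := kmin _ Pk1; have := kmin _ Pk2; have := segk k; have := segk k1; have := segk k2.
have ne1 : (enum_val k1).2 != (enum_val k).2 :> nat.
  apply: contra k1k => /eqP/val_inj k12; apply/eqP/enum_val_inj.
  by rewrite [LHS]surjective_pairing k1E k12 -surjective_pairing.
have ne2 : (enum_val k2).1 != (enum_val k).1 :> nat.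
  apply: contra k2k => /eqP/val_inj k22; apply/eqP/enum_val_inj.
  by rewrite [LHS]surjective_pairing k2E k22 -surjective_pairing.
move: nc ne1 ne2; rewrite /crossing k1E k2E.
move: (nat_of_ord (enum_val k).1) (nat_of_ord (enum_val k).2)
  (nat_of_ord (enum_val k1).2) (nat_of_ord (enum_val k2).1); clear; lia.
Qed.

Lemma mmap1_minor_neq0 e : mmap1 chart_minor e != 0.
Proof. by apply/prodf_neq0 => k _; apply/expf_neq0/minor_neq0/segk. Qed.

Lemma mlead_mmap1 e : mlead (mmap1 chart_minor e) = leads e.
Proof.
rewrite /mmap1 mlead_prod => [|k _ _]; last exact/expf_neq0/minor_neq0/segk.
apply: eq_bigr => k _; rewrite mleadX ?minor_neq0 ?segk //.
by rewrite mlead_minor ?segk.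
Qed.

(** The monomials of the chart have distinct leading monomials on the generic
    configuration, so the leading monomials of a polynomial do not cancel. *)
Lemma mlead_poly (p : {mpoly int[#|S|]}) : p != 0 ->
  exists2 e, e \in msupp p & mlead (mmap intr chart_minor p) = leads e.
Proof.
move=> p0.
have intE (z : int) : z%:~R = z%:MP :> R by rewrite -[z in RHS]intz rmorph_int.
have leadE e : e \in msupp p -> mlead ((p@_e)%:~R * mmap1 chart_minor e) = leads e.
  rewrite mcoeff_msupp => pe; rewrite mleadM ?mmap1_minor_neq0 //; last first.
    by rewrite intE mpolyC_eq0.
  by rewrite intE mleadC add0m mlead_mmap1.
have uniq_leads : uniq [seq mlead ((p@_e)%:~R * mmap1 chart_minor e) | e <- msupp p & true].
  rewrite filter_predT (_ : map _ _ = map leads (msupp p)); last exact/eq_in_map.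
  by rewrite map_inj_uniq ?msupp_uniq //; exact: leads_inj.
rewrite /mmap mlead_sum //.
case: ssrcomplements.bigjoinP => [|/nilP|e ep]; first exact: le_total.
  by move/eqP; rewrite msupp_eq0 (negPf p0).
by exists e => //; exact: leadE.
Qed.

(** If the value of [p] were zero, so would be the exponents of the leading terms
    of [p] and of its multiple by a coordinate, given by [mlead_poly]. *)
Lemma mmap_minor_neq0 (p : {mpoly int[#|S|]}) : p != 0 -> mmap intr chart_minor p != 0.
Proof.
move=> p0; apply/eqP => mp0.
have e01 : (ord0, inord 1) \in S.
  by apply: edge_with_edges; rewrite /is_edge /is_segment /= inordK.
pose k := enum_rank_in e01 (ord0, inord 1).
have Xk0 : 'X_k != 0 :> {mpoly int[#|S|]}.
  by rewrite -mleadc_eq0 mleadXm mcoeffX eqxx oner_eq0.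
have [e ep] := mlead_poly (mulf_neq0 p0 Xk0).
rewrite rmorphM /= mp0 mul0r mlead0.
have <- : leads 0%MM = 0%MM.
  by rewrite /leads big1 // => i _; apply/mnmP => j; rewrite mulmnE mnm0E muln0 mnm0E.
move/leads_inj => e0; have /msuppM_le/allpairsP[[u v] /= [_]] := ep.
rewrite msuppX inE -e0 => /eqP -> /(congr1 (fun q : monomials => q k)).
by rewrite mnm0E mnmDE mnm1E eqxx addn1.
Qed.

End OneChart.
End Leading.

(** * Expansion in noncrossing graphs *)

Section Degrees.
Variable n : nat.
Local Notation N := n.+3.
Implicit Types (G W : 'M[int]_N).

Definition starts (p i j : 'I_N) : int := (i == p)%:R.
Definition ends (p i j : 'I_N) : int := (j == p)%:R.

Definition same_degrees G H : Prop :=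
  (forall p, pairing (starts p) G = pairing (starts p) H) /\
  (forall p, pairing (ends p) G = pairing (ends p) H).

(** Replacing crossing [(i, k)] and [(j, l)] by [(i, l)] and [(j, k)] permutes the
    starts and the ends. *)
Lemma uncross G : weighted_graph G ->
  exists2 H, noncrossing_graph H & same_degrees H G.
Proof.
have [s] := ubnP (size_graph G); elim: s G => // s IHs G sG wG.
have [nc|nnc] := boolP (noncrossing_graph G); first by exists G.
have [/existsP[i /existsP[j /existsP[k /existsP[l /and5P[ij jk kl Gik Gjl]]]]]|no] := boolP
    [exists i : 'I_N, exists j : 'I_N, exists k : 'I_N, exists l : 'I_N,
      [&& (i < j)%N, (j < k)%N, (k < l)%N, 0 < G i k & 0 < G j l]]; last first.
  case/negP: nnc; apply/(noncrossing_graphP wG) => i j k l /andP[ij jk] kl Gik Gjl.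
  case/negP: no; apply/existsP; exists i; apply/existsP; exists j.
  by apply/existsP; exists k; apply/existsP; exists l; apply/and5P.
have ijk : (i < j < k)%N by rewrite ij.
have [so _] := size_resolve wG ijk kl Gik Gjl.
have [|H ncH [Hs He]] := IHs _ _ (weighted_outer wG ijk kl Gik Gjl).
  exact: leq_trans so _.
exists H => //; split=> p; [rewrite Hs|rewrite He]; rewrite pairing_outer // /starts /ends; ring.
Qed.

(** The closed walk [i, k, k - 1, n + 2, 0, i + 1, i] with alternating signs: equally
    many segments start, and end, at each vertex with either sign, and the steps
    that count negatively are edges. *)
Definition balanced_cycle (i k : 'I_N) : 'M[int]_N :=
  one_segment i k - one_segment (inord k.-1) k + one_segment (inord k.-1) ord_max
  - one_segment ord0 ord_max + one_segment ord0 (inord i.+1) - one_segment i (inord i.+1).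

Lemma pairing_combination f (A B C D E F : 'M[int]_N) :
  pairing f (A - B + C - D + E - F) = pairing f A - pairing f B + pairing f C
    - pairing f D + pairing f E - pairing f F.
Proof. by rewrite !(pairingD, pairingN). Qed.

Lemma balanced_degrees (i k : 'I_N) : (i < k)%N ->
  (forall p, pairing (starts p) (balanced_cycle i k) = 0) /\
  (forall p, pairing (ends p) (balanced_cycle i k) = 0).
Proof.
move=> ik; have kn := ltn_ord k.
have k1 : (inord k.-1 : 'I_N) = k.-1 :> nat by rewrite inordK //; lia.
have i1 : (inord i.+1 : 'I_N) = i.+1 :> nat by rewrite inordK //; lia.
split=> p; rewrite pairing_combination !pairing_one_segment ?k1 ?i1 //=; try lia.
all: rewrite /starts /ends; ring.
Qed.

Lemma edge_one_segment (i j x y : 'I_N) : is_edge (i, j) -> is_diagonal (x, y) ->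
  one_segment i j x y = 0.
Proof.
move=> e /andP[xy ne]; rewrite one_segmentE /=.
have -> : (x == i) && (y == j) = false.
  by apply: contraNF ne => /andP[/eqP-> /eqP->].
have -> // : (x == j) && (y == i) = false.
by apply/negP => /andP[/eqP ? /eqP ?]; subst; case/andP: e; rewrite /is_segment /= in xy *; lia.
Qed.

Lemma balanced_ge (i k x y : 'I_N) : (i < k)%N -> is_diagonal (x, y) ->
  ((x == i) && (y == k))%:R <= balanced_cycle i k x y.
Proof.
move=> ik d; have kn := ltn_ord k.
have k1 : (inord k.-1 : 'I_N) = k.-1 :> nat by rewrite inordK //; lia.
have i1 : (inord i.+1 : 'I_N) = i.+1 :> nat by rewrite inordK //; lia.
have e1 : is_edge (inord k.-1, k) by rewrite /is_edge /is_segment /= k1; lia.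
have e2 : is_edge (ord0 : 'I_N, ord_max : 'I_N) by rewrite /is_edge /is_segment /= eqxx.
have e3 : is_edge (i, inord i.+1) by rewrite /is_edge /is_segment /= i1; lia.
have pos (u v : 'I_N) : 0 <= one_segment u v x y by rewrite one_segmentE addr_ge0.
have entry (A B C D E F : 'M[int]_N) : (A - B + C - D + E - F) x y =
    A x y - B x y + C x y - D x y + E x y - F x y by rewrite !mxE.
rewrite /balanced_cycle entry !(edge_one_segment e1 d, edge_one_segment e2 d, edge_one_segment e3 d).
by rewrite !subr0 [one_segment i k x y]one_segmentE -!addrA lerDl !addr_ge0.
Qed.

(** Adding balanced cycles makes the weights of all diagonals non-negative. *)
Lemma weighted_degrees W : W^T = W -> (forall i, W i i = 0) ->
  exists2 G, weighted_graph G & same_degrees G W.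
Proof.
move=> Ws W0.
pose C := \sum_(s : segment n | is_segment s) `|W s.1 s.2| *: balanced_cycle s.1 s.2.
have pairingZ f z (H : 'M[int]_N) : pairing f (z *: H) = z * pairing f H.
  rewrite /pairing mulr_sumr; apply: eq_bigr => i _; rewrite mulr_sumr.
  by apply: eq_bigr => j _; rewrite mxE mulrCA.
have pairing_sum f (r : seq (segment n)) (P : pred (segment n)) F :
    (forall s, P s -> pairing f (F s) = 0) -> pairing f (\sum_(s <- r | P s) F s) = 0.
  move=> F0; apply: (big_ind (fun H => pairing f H = 0)) => // [|H H' h h'].
    by rewrite /pairing big1 // => i _; rewrite big1 // => j _; rewrite mxE mulr0.
  by rewrite pairingD h h'.
have degC f : (forall i k : 'I_N, (i < k)%N -> pairing f (balanced_cycle i k) = 0) ->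
    pairing f (W + C) = pairing f W.
  by move=> f0; rewrite pairingD pairing_sum ?addr0 // => s ss; rewrite pairingZ f0 ?mulr0.
have cycle_sym i k : (balanced_cycle i k)^T = balanced_cycle i k.
  have tr (B D E F H K : 'M[int]_N) : (B - D + E - F + H - K)^T =
      B^T - D^T + E^T - F^T + H^T - K^T by rewrite !(linearB, linearD).
  by rewrite /balanced_cycle tr !one_segment_sym.
have cycle_diag (i k x : 'I_N) : (i < k)%N -> balanced_cycle i k x x = 0.
  move=> ik; have kn := ltn_ord k.
  have k1 : (inord k.-1 : 'I_N) = k.-1 :> nat by rewrite inordK //; lia.
  have i1 : (inord i.+1 : 'I_N) = i.+1 :> nat by rewrite inordK //; lia.
  have entry (B D E F H K : 'M[int]_N) : (B - D + E - F + H - K) x x =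
    B x x - D x x + E x x - F x x + H x x - K x x by rewrite !mxE.
  rewrite /balanced_cycle entry !one_segment_diag ?k1 ?i1 //=; lia.
exists (W + C); last first.
  by split=> p; apply: degC => i k ik; have [H1 H2] := balanced_degrees ik.
apply/weightedP; split.
- rewrite linearD /= Ws linear_sum; congr (_ + _); apply: eq_bigr => s _.
  by rewrite linearZ /= cycle_sym.
- move=> i; rewrite mxE W0 summxE big1 ?addr0 // => s ss.
  by rewrite mxE cycle_diag ?mulr0.
move=> i j d; rewrite mxE summxE (bigD1 (i, j)) /=; last by case/andP: d.
have ij : (i < j)%N by case/andP: d.
rewrite addrA; apply: addr_ge0; last first.
  apply: sumr_ge0 => s /andP[ss _]; rewrite mxE mulr_ge0 //.
  by apply: le_trans (balanced_ge ss d).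
have := balanced_ge ij d; rewrite !eqxx [(`|W i j| *: balanced_cycle i j) i j]mxE => c1.
rewrite -[W i j]opprK addrC subr_ge0 opprK; apply: le_trans (ler_norm _) _.
by rewrite normrN ler_peMr.
Qed.

End Degrees.

Section Expansion.
Variables (n : nat) (X : positive_space n).
Local Notation N := n.+3.
Implicit Types (G W : 'M[int]_N) (T : {set segment n}).
Local Notation I := (graph_monomial X).

Lemma noncrossing0 : noncrossing_graph (0 : 'M[int]_N).
Proof.
have w0 : weighted_graph (0 : 'M[int]_N).
  by apply/weightedP; split=> [|i|i j _]; rewrite ?trmx0 ?mxE.
by apply/(noncrossing_graphP w0) => i j k l _ _; rewrite mxE ltxx.
Qed.

(** The leading exponents record how many segments start and end at each vertex. *)
Lemma leads_degrees T (triT : complete_triangulation T)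
    (u v : 'X_{1..#|with_edges T|}) (z : 'I_#|with_edges T| -> int) :
  (forall k, z k = (u k)%:Z - (v k)%:Z) ->
  (forall p, pairing (starts p) (graph_of z) =
     (leads u (lshift N p))%:Z - (leads v (lshift N p))%:Z) /\
  (forall p, pairing (ends p) (graph_of z) =
     (leads u (rshift N p))%:Z - (leads v (rshift N p))%:Z).
Proof.
have natz_sum (w : 'X_{1..#|with_edges T|}) (b : 'I_#|with_edges T| -> bool) :
    (\sum_(k < #|with_edges T|) b k * w k)%N%:Z =
    \sum_(k < #|with_edges T|) (w k)%:Z * (b k)%:R.
  rewrite (big_morph Posz PoszD (erefl _)); apply: eq_bigr => k _.
  by rewrite PoszM mulrC; case: (b k).
move=> zE; split=> p; rewrite pairing_graph_of // ?leads_x ?leads_y !natz_sum -sumrB;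
  by apply: eq_bigr => k _; rewrite zE mulrBl.
Qed.

(** On the generic configuration, the leading monomial of [f] is that of the
    monomial of some noncrossing graph [G]; in a chart that contains [G], no other
    term of [f] can produce it. *)
Lemma no_coef_eq0 (f : X) :
  (forall G, noncrossing_graph G -> has_coef (chart_of G) G f 0) -> f = 0.
Proof.
move=> coef0; apply/eqP/negPn/negP => f0.
have [tri0 _] := chart_ofP noncrossing0; set T0 := chart_of 0 in tri0.
have [p0 [m0 [fE0 _]]] := coef0 _ noncrossing0; rewrite -/T0 in p0 m0 fE0.
have p0_neq0 : p0 != 0.
  by apply: contraNneq f0 => p00; rewrite fE0 p00 /poly_in rmorph0 mul0r.
have [e0 e0p lead0] := mlead_poly tri0 p0_neq0.
pose z k : int := (e0 k)%:Z - (m0 k)%:Z.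
have [W wW [degWs degWe]] := weighted_degrees (graph_of_sym z) (graph_of_diag tri0 z).
have [G ncG [degGs degGe]] := uncross wW.
have [zs ze] := leads_degrees tri0 (fun k => erefl (z k)).
have wG := noncrossing_weighted ncG.
have [triT GT] := chart_ofP ncG; set T := chart_of G in triT GT.
have [p [m [fE coefG]]] := coef0 G ncG; rewrite -/T in p m fE coefG.
have p_neq0 : p != 0.
  by apply: contraNneq f0 => p00; rewrite fE p00 /poly_in rmorph0 mul0r.
have [e ep leadp] := mlead_poly triT p_neq0.
have [Gs Ge] := leads_degrees triT (fun k => esym (pos_neg_exp G k)).
rewrite (graph_ofK triT wG GT) in Gs Ge.
(* The two expansions of f agree on the space, hence on the generic configuration. *)
have cross : mmap intr (@chart_minor n _) p0 *
    mmap1 (@chart_minor n _) m =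
    mmap intr (@chart_minor n _) p *
    mmap1 (@chart_minor n _) m0.
  pose F (K : fieldType) (a : 'I_N -> 'I_N -> K) :=
    poly_in a p0 * poly_in a ('X_[m] : {mpoly int[#|with_edges T|]}) +
    (-1)%:~R * (poly_in a p * poly_in a ('X_[m0] : {mpoly int[#|with_edges T0|]})).
  have uF : universal_laurent false T F.
    have segT s : s \in with_edges T -> is_segment s := @with_edges_segment _ _ triT s.
    have segT0 s : s \in with_edges T0 -> is_segment s := @with_edges_segment _ _ tri0 s.
    apply: (universalD triT); apply: universalM; try exact: universal_poly.
      exact: universal_int.
    by apply: universalM; exact: universal_poly.
  have F0 : F X (A X) = 0.
    have n0 := config_monomial_neq0 tri0 m0 (A_config X).
    have nT := config_monomial_neq0 triT m (A_config X).
    have E0 : poly_in (A X) p0 = f * mmap1 (coordinates (A X) (S := _)) m0.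
      by rewrite fE0 divfK.
    have ET : poly_in (A X) p = f * mmap1 (coordinates (A X) (S := _)) m.
      by rewrite fE divfK.
    by rewrite /F E0 ET !poly_inXm; ring.
  have := transfer triT uF F0 (generic_plucker n).
  rewrite /F mulN1r => /eqP; rewrite subr_eq0 !poly_in_generic -!tofracM.
  by rewrite -subr_eq0 -tofracB tofrac_eq0 subr_eq0 !mmapX => /eqP.
have := congr1 (@mlead _ _) cross.
rewrite !mleadM ?mmap1_minor_neq0 ?mmap_minor_neq0 //.
rewrite lead0 leadp !mlead_mmap1 // => leadE.
have : leads (e + neg_exp T G)%MM = leads (m + pos_exp T G)%MM.
  rewrite !leadsD; apply/mnmP => i; have := congr1 (fun q : 'X_{1..N + N} => q i) leadE.
  rewrite !mnmDE; case: (split_ordP i) => q ->.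
    have := Gs q; rewrite degGs degWs zs.
    move: (leads e0 _) (leads m0 _) (leads e _) (leads m _) (leads (pos_exp _ _) _)
      (leads (neg_exp _ _) _); clear; lia.
  have := Ge q; rewrite degGe degWe ze.
  move: (leads e0 _) (leads m0 _) (leads e _) (leads m _) (leads (pos_exp _ _) _)
    (leads (neg_exp _ _) _); clear; lia.
move/(leads_inj triT) => eE; move: ep; rewrite mcoeff_msupp => /eqP[].
by rewrite -coefG -eE addmC mcoeffMX.
Qed.

End Expansion.

(** * Extremal elements *)

Section Extremal.
Variables (n : nat) (X : positive_space n).
Local Notation N := n.+3.
Implicit Types (G H : 'M[int]_N) (T : {set segment n}).
Local Notation I := (graph_monomial X).

Lemma has_coef_sum T (triT : complete_triangulation T) G (Hs : seq 'M[int]_N)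
    (f : 'M[int]_N -> X) (c : 'M[int]_N -> int) :
  (forall H, H \in Hs -> has_coef T G (f H) (c H)) ->
  has_coef T G (\sum_(H <- Hs) f H) (\sum_(H <- Hs) c H).
Proof.
elim: Hs => [|H Hs IHs] fc.
  rewrite !big_nil; exists 0, 0%MM; split; last by rewrite mul0r mcoeff0.
  by rewrite /poly_in rmorph0 mul0r.
rewrite !big_cons; apply: has_coefD => //; first by apply: fc; rewrite mem_head.
by apply: IHs => K KHs; apply: fc; rewrite inE KHs orbT.
Qed.

(** The sum of the monomials of noncrossing graphs with the coefficients found in
    [F] has the same coefficients as [F], so it is [F]. *)
Lemma noncrossing_expansion (F : X) : Lplus F ->
  exists (Gs : seq 'M[int]_N) (c : 'M[int]_N -> int),
    [/\ uniq Gs, forall G, G \in Gs -> noncrossing_graph G,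
        forall G, G \in Gs -> 0 <= c G
      & F = \sum_(G <- Gs) (c G)%:~R * I G].
Proof.
move=> LF.
have /fin_all_exists[d dP] T : exists d : seq 'M[int]_N * ('M[int]_N -> int),
    complete_triangulation T -> forall G, weighted_graph G -> in_chart T G ->
    [/\ has_coef T G F (d.2 G), 0 <= d.2 G & d.2 G != 0 -> G \in d.1].
  have [triT|] := boolP (complete_triangulation T); last by exists ([::], fun=> 0).
  by have [Gs [c H]] := finite_coefs triT LF; exists (Gs, c).
pose Gs := undup [seq G <- flatten [seq (d T).1 | T <- enum {set segment n}]
  | noncrossing_graph G].
pose c G := (d (chart_of G)).2 G.
have cP G : noncrossing_graph G ->
    [/\ has_coef (chart_of G) G F (c G), 0 <= c G & c G != 0 -> G \in Gs].
  move=> ncG; have [triG GT] := chart_ofP ncG.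
  have [h1 h2 h3] := dP _ triG G (noncrossing_weighted ncG) GT; split => // /h3 Gd.
  rewrite mem_undup mem_filter ncG; apply/flattenP; exists (d (chart_of G)).1 => //.
  by apply/mapP; exists (chart_of G); rewrite ?mem_enum.
have Gs_nc G : G \in Gs -> noncrossing_graph G.
  by rewrite mem_undup mem_filter => /andP[].
exists Gs, c; split; [exact: undup_uniq|exact: Gs_nc|by move=> G /Gs_nc/cP[]|].
apply/eqP; rewrite -subr_eq0; apply/eqP/no_coef_eq0 => G ncG.
have [triG GT] := chart_ofP ncG; have wG := noncrossing_weighted ncG.
have [cG _ cGs] := cP G ncG.
have -> : F - \sum_(H <- Gs) (c H)%:~R * I H =
          F + (-1)%:~R * \sum_(H <- Gs) (c H)%:~R * I H by rewrite mulN1r.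
have sum0 : c G + -1 * \sum_(H <- Gs) c H * (G == H)%:R = 0.
  have [Gin|Gout] := boolP (G \in Gs).
    rewrite (bigD1_seq G) ?undup_uniq //= eqxx big1 => [|H]; first by rewrite mulr1 addr0 mulN1r subrr.
    by rewrite eq_sym => /negPf->; rewrite mulr0.
  rewrite big_seq big1 => [|H HGs]; first last.
    by case: eqP => [e|_]; rewrite ?mulr0 //; rewrite e HGs in Gout.
  by rewrite mulr0 addr0; apply/eqP; apply: contraR Gout => /cGs.
suff : has_coef (chart_of G) G (F + (-1)%:~R * \sum_(H <- Gs) (c H)%:~R * I H)
    (c G + -1 * \sum_(H <- Gs) c H * (G == H)%:R) by rewrite sum0.
apply: has_coefD => //; apply: has_coefZ; apply: has_coef_sum => // H /Gs_nc ncH.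
apply: has_coefZ; have [<-|GH] := eqVneq G H; first exact: has_coef_self.
exact: has_coef_other.
Qed.

Lemma LplusZ (z : int) G : 0 <= z -> weighted_graph G -> Lplus (z%:~R * I G).
Proof.
move=> z0 wG; apply: (@Lplus_universal _ X (fun K a => z%:~R * config_monomial G a)) => T triT.
apply: (universalM _ (universal_monomial triT true wG)).
exact: universal_int.
Qed.

Lemma Lplus_sum (Gs : seq 'M[int]_N) (c : 'M[int]_N -> int) :
  (forall G, G \in Gs -> weighted_graph G) -> (forall G, G \in Gs -> 0 <= c G) ->
  Lplus (\sum_(G <- Gs) (c G)%:~R * I G).
Proof.
move=> wGs c0; rewrite big_seq; apply: big_ind; first exact: Lplus0.
  exact: LplusD.
by move=> G GGs; apply: LplusZ; [exact: c0|exact: wGs].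
Qed.

(** One term of [noncrossing_expansion] already exhausts an extremal element. *)
Lemma extremal_monomial (F : X) : extremal F ->
  exists2 G, noncrossing_graph G & F = I G.
Proof.
move=> [LF F0 irr]; have [Gs [c [uGs ncGs c0 FE]]] := noncrossing_expansion LF.
have wGs G : G \in Gs -> weighted_graph G by move/ncGs/noncrossing_weighted.
have [/hasP[G GGs cG]|/hasPn none] := boolP (has (fun G => c G != 0) Gs); last first.
  case/eqP: F0; rewrite FE big_seq big1 // => G /none; rewrite negbK => /eqP ->.
  by rewrite mul0r.
exists G; first exact: ncGs.
pose rest := (c G - 1)%:~R * I G + \sum_(H <- rem G Gs) (c H)%:~R * I H.
have FG : F = I G + rest.
  rewrite FE (perm_big _ (perm_to_rem GGs)) big_cons /rest addrA; congr (_ + _).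
  by rewrite rmorphB /= mulrBl mul1r addrC subrK.
have IG0 : I G != 0 by apply/prodf_neq0 => i _; apply/prodf_neq0 => j ij; rewrite expfz_neq0 ?A_neq0.
have Lrest : Lplus rest.
  apply: LplusD.
    by apply: LplusZ; [rewrite subr_ge0 -gtz0_ge1 lt_neqAle eq_sym cG c0|exact: wGs].
  by apply: Lplus_sum => H /mem_rem; [exact: wGs|exact: c0].
have [rest0|rest0] := eqVneq rest 0; first by rewrite FG rest0 addr0.
by case: irr; exists (I G), rest; split => //; exact/Lplus_monomial/wGs.
Qed.

(** In a chart containing the graph, its monomial is a single Laurent monomial
    with coefficient one, which is no sum of two nonzero positive ones. *)
Lemma noncrossing_extremal G : noncrossing_graph G -> extremal (I G).
Proof.
move=> ncG; have wG := noncrossing_weighted ncG; have [triT GT] := chart_ofP ncG.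
set T := chart_of G in triT GT.
have IG0 : I G != 0 by apply/prodf_neq0 => i _; apply/prodf_neq0 => j ij; rewrite expfz_neq0 ?A_neq0.
split => //; first exact: Lplus_monomial.
case=> f1 [f2 [/(_ T triT)[p1 [m1 [p1_ge0 f1E]]] f1_0 /(_ T triT)[p2 [m2 [p2_ge0 f2E]]] f2_0 IE]].
have m0 (k : 'X_{1..#|with_edges T|}) := config_monomial_neq0 triT k (A_config X).
pose q1 := p1 * 'X_[m2 + neg_exp T G]; pose q2 := p2 * 'X_[m1 + neg_exp T G].
have qE : q1 + q2 = 'X_[m1 + m2 + pos_exp T G].
  apply/eqP; rewrite -subr_eq0; apply/eqP/(chart_independent triT); move: IE.
  rewrite [I G](config_monomial_in_chart triT (A_config X) wG GT).
  rewrite f1E f2E addf_div // => /eqP; rewrite eqr_div ?mulf_neq0 // => /eqP H.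
  rewrite /poly_in rmorphB rmorphD !rmorphM /= -!/(poly_in _ _) !poly_inXm !mmap1D.
  apply/eqP; rewrite subr_eq0; apply/eqP.
  by transitivity ((poly_in (A X) p1 * mmap1 (coordinates (A X) (S := with_edges T)) m2 +
    poly_in (A X) p2 * mmap1 (coordinates (A X) (S := with_edges T)) m1) *
    mmap1 (coordinates (A X) (S := with_edges T)) (neg_exp T G)); [ring | rewrite -H; ring].
set u := (m1 + m2 + pos_exp T G)%MM in qE.
have q_ge0 (p : {mpoly int[#|with_edges T|]}) m : (forall e, 0 <= p@_e) ->
    forall e, 0 <= (p * 'X_[m])@_e.
  by move=> p0 e; apply: mcoeff_nonneg_mul => // ?; exact: mcoeffXm_ge0.
have q1_ge0 := q_ge0 _ (m2 + neg_exp T G)%MM p1_ge0.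
have q2_ge0 := q_ge0 _ (m1 + neg_exp T G)%MM p2_ge0.
have sumE e : q1@_e + q2@_e = (u == e)%:R by rewrite -mcoeffD qE mcoeffX.
have vanish (p : {mpoly int[#|with_edges T|]}) m m' :
    (forall e, (p * 'X_[m])@_e = 0) ->
    poly_in (A X) p / mmap1 (coordinates (A X) (S := with_edges T)) m' = 0.
  move=> p0; have -> : p = 0; last by rewrite /poly_in rmorph0 mul0r.
  by apply/mpolyP => e; rewrite mcoeff0 -(mcoeffMX p m) p0.
have [q1u|q1u] := eqVneq q1@_u 0.
  case/eqP: f1_0; rewrite f1E; apply: (vanish _ (m2 + neg_exp T G)%MM) => e; rewrite -/q1.
  have [<-//|ue] := eqVneq u e.
  by have := sumE e; have := q1_ge0 e; have := q2_ge0 e; rewrite (negPf ue) -/q1 -/q2; lia.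
case/eqP: f2_0; rewrite f2E; apply: (vanish _ (m1 + neg_exp T G)%MM) => e; rewrite -/q2.
have := sumE e; have := q1_ge0 e; have := q2_ge0 e; rewrite -/q1 -/q2.
have [<-|ue] := eqVneq u e; last by lia.
by move: q1u; lia.
Qed.

Lemma noncrossing_segment (i j : 'I_N) : (i < j)%N -> noncrossing_graph (one_segment i j).
Proof.
move=> ij; have w : weighted_graph (one_segment i j).
  by apply: weighted_one_segment; exact: neq_lt.
have only (x y : 'I_N) : (x < y)%N -> 0 < one_segment i j x y -> x = i /\ y = j.
  move=> xy; rewrite one_segmentE.
  have [/andP[/eqP-> /eqP->] //|_] := boolP ((x == i) && (y == j)).
  have [/andP[/eqP xj /eqP yi]|//] := boolP ((x == j) && (y == i)).
  by move: xy; rewrite xj yi ltnNge (ltnW ij).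
apply/(noncrossing_graphP w) => x y z t /andP[xy yz] zt H1 H2.
have [xi _] := only _ _ (ltn_trans xy yz) H1; have [yi _] := only _ _ (ltn_trans yz zt) H2.
by rewrite xi yi ltnn in xy.
Qed.

Lemma noncrossing_edgeN (i j : 'I_N) : is_edge (i, j) -> noncrossing_graph (- one_segment i j).
Proof.
move=> e; have ij : (i < j)%N by case/andP: e.
have w : weighted_graph (- one_segment i j).
  apply/weightedP; split.
  - by rewrite linearN /= one_segment_sym.
  - by move=> x; rewrite mxE one_segment_diag ?oppr0.
  - by move=> x y d; rewrite mxE edge_one_segment ?oppr0.
apply/(noncrossing_graphP w) => x y z t _ _; rewrite mxE oppr_gt0 one_segmentE.
by rewrite ltNge addr_ge0.
Qed.

Lemma config_monomialN (K : fieldType) (a : 'I_N -> 'I_N -> K) G : plucker_config a ->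
  config_monomial (- G) a = (config_monomial G a)^-1.
Proof.
move=> ca; have GN : config_monomial G a * config_monomial (- G) a = 1.
  by rewrite -config_monomialD // subrr config_monomial0.
by rewrite -[RHS]mulr1 -GN mulKf //; apply: contra_eq_neq GN => ->; rewrite mul0r eq_sym oner_eq0.
Qed.

Lemma extremal_product1 : extremal_product (1 : X).
Proof. by exists [::]; rewrite big_nil. Qed.

Lemma extremal_productM (f g : X) :
  extremal_product f -> extremal_product g -> extremal_product (f * g).
Proof.
move=> [r [re ->]] [s [se ->]]; exists (r ++ s); rewrite big_cat; split=> // h.
by rewrite mem_cat => /orP[/re|/se].
Qed.

Lemma extremal_productX (f : X) m : extremal f -> extremal_product (f ^+ m).
Proof.
move=> ef; elim: m => [|m IHm]; first exact: extremal_product1.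
rewrite exprS; apply: extremal_productM => //.
by exists [:: f]; rewrite big_seq1; split=> // g; rewrite inE => /eqP ->.
Qed.

Lemma monomial_extremal_product G : weighted_graph G -> extremal_product (I G).
Proof.
case/weightedP=> _ _ Gd; apply: big_ind; [exact: extremal_product1|exact: extremal_productM|].
move=> i _; apply: big_ind; [exact: extremal_product1|exact: extremal_productM|].
move=> j ij; have eA := noncrossing_extremal (noncrossing_segment ij).
rewrite graph_monomialE config_monomial_one_segment // in eA.
have [d|nd] := boolP (is_diagonal (i, j)).
  by have := Gd i j d; case: (G i j) => // w _; exact: extremal_productX.
have e : is_edge (i, j) by move: nd; rewrite /is_diagonal /is_segment /= ij negbK.
have eV := noncrossing_extremal (noncrossing_edgeN e).
rewrite graph_monomialE config_monomialN ?config_monomial_one_segment // in eV; last exact: A_config.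
case: (G i j) => w; first exact: extremal_productX.
by rewrite NegzE -exprz_inv; exact: extremal_productX.
Qed.

Lemma extremal_product_monomial (F : X) : extremal_product F ->
  exists2 G, weighted_graph G & I G = F.
Proof.
case=> s [es ->]; elim: s es => [|f s IHs] es.
  exists 0; first exact/noncrossing_weighted/noncrossing0.
  by rewrite big_nil; exact: config_monomial0.
have [|G wG GE] := IHs; first by move=> g gs; apply: es; rewrite inE gs orbT.
have [H ncH fE] := extremal_monomial (es f (mem_head _ _)).
exists (H + G); first exact: weightedD (noncrossing_weighted ncH) wG.
by rewrite big_cons fE -GE; exact: (config_monomialD (A_config X)).
Qed.

End Extremal.

Theorem theorem2p13 (n : nat) (hn : (1 <= n)%N) (X : positive_space n) :
  [/\ forall G, weighted_graph G -> extremal_product (graph_monomial X G),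
      {in @weighted_graph n &, injective (graph_monomial X)} &
      forall F : X, extremal_product F ->
        exists2 G, weighted_graph G & graph_monomial X G = F]
  /\
  (forall G1 G2 : 'M[int]_n.+3, weighted_graph G1 -> weighted_graph G2 ->
    (Lle (graph_monomial X G1) (graph_monomial X G2) <->
     (forall p : 'I_n.+3, vertex_weight p G1 = vertex_weight p G2) /\
     (forall k l : 'I_n.+3, is_diagonal (k, l) ->
        cut_weight k l G1 <= cut_weight k l G2))).
Proof.
split; last exact: LleP.
split; first exact: monomial_extremal_product.
  exact: graph_monomial_inj.
exact: extremal_product_monomial.
Qed.
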